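(* Let $\Theta=\tilde p/p$ be a rational inner function on $\mathbb{D}^2$ of degree $(m,n)$, let $\mathcal{K}_\Theta=\mathcal{S}_1\oplus\mathcal{S}_2$ be an orthogonal decomposition into closed subspaces with $\mathcal{S}_1$ invariant under $M_{z_1}$ and $\mathcal{S}_2$ invariant under $M_{z_2}$, and let $S^1_\Theta=P_{\mathcal{S}_2}M_{z_1}|_{\mathcal{S}_2}$. Let $\{q_1/p,\dots,q_m/p\}$ be an orthonormal basis of $\mathcal{S}_2\ominus z_2\mathcal{S}_2$ with each $q_i$ a polynomial, and let $\mathcal{U}:H^2_2(\mathbb{D})^m\to\mathcal{S}_2$ be the unitary $\mathcal{U}(f_1,\dots,f_m)=\sum_{i=1}^m\frac{q_i}{p}f_i$. Then there exists an $m\times m$ matrix-valued function $M_\Theta$, whose entries are rational functions of $\bar z_2$ and continuous on $\overline{\mathbb{D}}$, such that \[S^1_\Theta=\mathcal{U}\,T_{M_\Theta}\,\mathcal{U}^*.\]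
   Context: $\mathbb{D}$ is the open unit disk, $\mathbb{T}$ the unit circle, $H^2(\mathbb{D}^2)$ the Hardy space of the bidisk. A rational inner function on $\mathbb{D}^2$ is a rational function holomorphic on $\mathbb{D}^2$ with $|\Theta|=1$ a.e. on $\mathbb{T}^2$; its degree $(m,n)$ is defined by writing $\Theta=q/p$ in lowest terms, $m$ (resp. $n$) being the highest power of $z_1$ (resp. $z_2$) appearing in $p$ or $q$. One may write $\Theta=\tilde p/p$ with $p$ a polynomial with no zeros on $\mathbb{D}^2$, $\tilde p(z)=z_1^mz_2^n\overline{p(1/\bar z_1,1/\bar z_2)}$, $p,\tilde p$ coprime. $\mathcal{K}_\Theta=H^2(\mathbb{D}^2)\ominus\Theta H^2(\mathbb{D}^2)$. The space $\mathcal{S}_2\ominus z_2\mathcal{S}_2$ has dimension $m$ and has an orthonormal basis of the stated form, and the map $\mathcal{U}$ so defined is unitary. $H^2_2(\mathbb{D})$ is the one-variable Hardy space in the variable $z_2$, $H^2_2(\mathbb{D})^m$ its $m$-fold direct sum, $L^2_2(\mathbb{T})^m$ likewise. For a bounded $m\times m$ matrix function $F$ on $\mathbb{T}$, the $z_2$-matrix-valued Toeplitz operator is $T_F:H^2_2(\mathbb{D})^m\to H^2_2(\mathbb{D})^m$, $T_F\vec f=P_{H^2_2(\mathbb{D})^m}(F\vec f)$, where $P_{H^2_2(\mathbb{D})^m}$ is the orthogonal projection of $L^2_2(\mathbb{T})^m$ onto $H^2_2(\mathbb{D})^m$. *)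

(* Defs.v *)
From HB Require Import structures.
From mathcomp Require Import all_boot all_order all_algebra.
From mathcomp Require Import all_classical all_reals all_analysis.
From mathcomp Require Import complex.
Set Implicit Arguments. Unset Strict Implicit. Unset Printing Implicit Defensive.
Import Order.TTheory GRing.Theory Num.Theory.
Import numFieldNormedType.Exports.
Local Open Scope classical_set_scope.
Local Open Scope ring_scope.

Section Defs.
Variable R : realType.
Local Notation C := R[i].

(* Elements of H^2(D^2) are identified with their Taylor coefficient arrays
   f i j = coefficient of z1^i z2^j ; elements of H^2_2(D) with coefficient
   sequences f k = coefficient of z2^k. *)
Definition ps2 := nat -> nat -> C.
Definition ps1 := nat -> C.

Definition limC (u : nat -> C) : C := lim ((u : nat -> C^o) @ \oo).
Definition cvgC (u : nat -> C) (l : C) : Prop := (u : nat -> C^o) @ \oo --> (l : C^o).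

Definition inH2 (f : ps2) : Prop :=
  exists M : C, forall N : nat, \sum_(i < N) \sum_(j < N) `|f i j| ^+ 2 <= M.
Definition inH2_1 (f : ps1) : Prop :=
  exists M : C, forall N : nat, \sum_(k < N) `|f k| ^+ 2 <= M.

Definition ip (f g : ps2) : C :=
  limC (fun N : nat => \sum_(i < N) \sum_(j < N) f i j * Num.conj (g i j)).
Definition ip1 (f g : ps1) : C :=
  limC (fun N : nat => \sum_(k < N) f k * Num.conj (g k)).

Definition ps_add (f g : ps2) : ps2 := fun i j => f i j + g i j.
Definition ps_sub (f g : ps2) : ps2 := fun i j => f i j - g i j.
Definition ps_zero : ps2 := fun _ _ => 0.

(* multiplication by z1, z2 *)
Definition shift1 (f : ps2) : ps2 :=
  fun i j => if i is i'.+1 then f i' j else 0.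
Definition shift2 (f : ps2) : ps2 :=
  fun i j => if j is j'.+1 then f i j' else 0.

Definition ps_mul (f g : ps2) : ps2 :=
  fun i j => \sum_(a < i.+1) \sum_(b < j.+1) f a b * g (i - a)%N (j - b)%N.

Definition ps_mul2 (f : ps2) (g : ps1) : ps2 :=
  fun i j => \sum_(b < j.+1) f i b * g (j - b)%N.

Definition closed_subspace (S : set ps2) : Prop :=
  [/\ (forall f, S f -> inH2 f),
      S ps_zero,
      (forall (a : C) f g, S f -> S g -> S (fun i j => a * f i j + g i j)) &
      (forall (u : nat -> ps2) f, (forall k, S (u k)) -> inH2 f ->
          cvgC (fun k => ip (ps_sub (u k) f) (ps_sub (u k) f)) 0 ->
          S f)].

Definition is_proj (S : set ps2) (f g : ps2) : Prop :=
  S g /\ forall h, S h -> ip (ps_sub f g) h = 0.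

(* polynomials in two variables: p = \sum_i p`_i(z2) z1^i *)
Definition poly2 := {poly {poly C}}.
Definition coef2 (p : poly2) : ps2 := fun i j => (p`_i)`_j.
Definition eval2 (p : poly2) (z1 z2 : C) : C :=
  (map_poly (fun c : {poly C} => c.[z2]) p).[z1].
Definition deg1 (p : poly2) : nat := (size p).-1.
Definition pcoef (p : poly2) (i : nat) : {poly C} := p`_i.
Definition deg2 (p : poly2) : nat := (\max_(i < size p) size (pcoef p i))%N.-1.
(* p~(z) = z1^m z2^n conj(p(1/conj z1, 1/conj z2)) *)
Definition refl2 (m n : nat) (p : poly2) : poly2 :=
  \poly_(i < m.+1) \poly_(j < n.+1) Num.conj ((p`_(m - i))`_(n - j)).
Definition pdvd (d q : poly2) : Prop := exists r, q = r * d.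
Definition pcoprime (p q : poly2) : Prop :=
  forall d, pdvd d p -> pdvd d q -> d \is a GRing.unit.

Definition expi (t : R) : C := Complex (cos t) (sin t).
Definition fourier (F : C -> C) (k : int) : C :=
  let g := fun t : R => F (expi t) * (expi t) ^ (- k) in
  Complex ((pi *+ 2)^-1) 0 *
  Complex (\int[@lebesgue_measure R]_(t in `[0, pi *+ 2]) complex.Re (g t))
          (\int[@lebesgue_measure R]_(t in `[0, pi *+ 2]) complex.Im (g t)).

Definition toeplitz (m : nat) (F : 'I_m -> 'I_m -> C -> C) (v : 'I_m -> ps1)
  : 'I_m -> ps1 :=
  fun a k => \sum_(b < m)
     limC (fun N : nat => \sum_(l < N) fourier (F a b) (k%:Z - l%:Z) * v b l).

Definition closed_disk : set C := [set z | `|z| <= 1].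
Definition rational_conj_cont (F : C -> C) : Prop :=
  (exists a b : {poly C}, b != 0 /\
     forall z, closed_disk z -> b.[Num.conj z] != 0 ->
       F z = a.[Num.conj z] / b.[Num.conj z]) /\
  {within (closed_disk : set C^o), continuous (F : C^o -> C^o)}.

End Defs.

Section Defs2.
Variable R : realType.
Local Notation C := R[i].
Definition K_Theta (theta : ps2 R) (f : ps2 R) : Prop :=
  inH2 f /\ forall g, inH2 g -> ip f (ps_mul theta g) = 0.
Definition S2_wandering (S2 : set (ps2 R)) (f : ps2 R) : Prop :=
  S2 f /\ forall g, S2 g -> ip f (shift2 g) = 0.
Definition Uop (m : nat) (e : 'I_m -> ps2 R) (v : 'I_m -> ps1 R) : ps2 R :=
  fun a b => \sum_(i < m) ps_mul2 (e i) (v i) a b.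
Definition is_adjU (m : nat) (e : 'I_m -> ps2 R) (h : ps2 R) (v : 'I_m -> ps1 R)
  : Prop :=
  (forall i, inH2_1 (v i)) /\
  forall w : 'I_m -> ps1 R, (forall i, inH2_1 (w i)) ->
    ip (Uop e w) h = \sum_(i < m) ip1 (w i) (v i).
End Defs2.

(* Main.v *)
(* The backward shift B = M_{z1}^* maps S2 into itself: K_Theta is invariant under
   B, and S1 is invariant under M_{z1}, so B f is orthogonal to S1 for f in S2.
   Since B commutes with M_{z2}, the operator B is multiplication by an analytic
   matrix in the Wold basis z2^k e_i of S2, namely B e_a = sum_b e_b g_ab(z2), and
   the compression of M_{z1} is the Toeplitz operator with the conjugate-transposed
   symbol.  Multiplying by p and comparing powers of z1 gives a linear system over
   C[z2] for the g_ab; the q_b are independent over C[z2], so each g_ab is rational,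
   and a rational function with square-summable coefficients has no pole in the
   closed disk.

   That B preserves K_Theta needs multiplication by Theta to be bounded on H^2.
   In one variable, the coefficients of p~ f below any degree have at most the norm
   of those of p f (Schur-Cohn); slicing along |z2| = 1 and averaging over roots of
   unity gives the same comparison on the bidisk. *)
Require Import Defs.
From HB Require Import structures.
From mathcomp Require Import all_boot all_order all_algebra.
From mathcomp Require Import cyclic separable cyclotomic generic_quotient fraction.
From mathcomp Require Import all_classical all_reals all_analysis.
From mathcomp Require Import complex.
From mathcomp Require Import ring lra zify.
Import Order.TTheory GRing.Theory Num.Theory.
Import numFieldNormedType.Exports.
Local Open Scope classical_set_scope.
Local Open Scope ring_scope.
Set Implicit Arguments. Unset Strict Implicit. Unset Printing Implicit Defensive.


(** * Complex numbers and sequences *)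

(** Functions are coefficient arrays, so elements of [H^2] have no boundary values here and every
    estimate is made on finite blocks and then passed to the limit. This shapes the bound on
    [Theta g]: it is proved for truncations of [g], and Schur-Cohn is used on slices [|z2| = 1],
    where the hypothesis on the open bidisk says nothing about zeros of [p]. Replacing [z2] by
    [r z2] with [r < 1] makes these slices zero-free, and the resulting bound does not depend on
    [r].

    The symbol is the only object given by its values on the circle. Its Fourier integrals are
    matched with Taylor coefficients without summing a series: both satisfy one linear recurrence
    with constant coefficients, whose bounded two-sided solutions are unique when the denominator
    has no zero in the closed disk.

    The symbol is anti-analytic because [z2^l e_b] is orthogonal to [z2^k S2] whenever [l < k].
    Independence of the [q_b] over [C[z2]] comes from orthonormality of the vectors [z2^k e_i]. *)

Lemma sum_ord_widen (V : zmodType) (U : nat -> V) (N N' : nat) : (N <= N')%N ->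
  (forall k, (N <= k)%N -> U k = 0) -> \sum_(k < N') U k = \sum_(k < N) U k.
Proof.
move=> NN U0; rewrite -(subnKC NN) big_split_ord /= [X in _ + X]big1 ?addr0 // => k _.
by rewrite U0 // leq_addr.
Qed.

Section ComplexModulus.
Context {R : realType}.
Local Notation C := R[i].
Implicit Types (x y z : C) (t : R).

(** Valued in [R], unlike [|z| ^+ 2], which lives in the partially ordered [R[i]]; suprema, monotone
    limits and [lra] then apply. *)
Definition sqmod z : R := complex.Re z ^+ 2 + complex.Im z ^+ 2.

Lemma conjE z : Num.conj z = conjc z.
Proof. by case: z. Qed.

Lemma Re_mul x y : complex.Re (x * y) =
  complex.Re x * complex.Re y - complex.Im x * complex.Im y.
Proof. by case: x; case: y. Qed.

Lemma Im_mul x y : complex.Im (x * y) =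
  complex.Re x * complex.Im y + complex.Im x * complex.Re y.
Proof. by case: x; case: y. Qed.

Lemma Re_add x y : complex.Re (x + y) = complex.Re x + complex.Re y.
Proof. by case: x; case: y. Qed.

Lemma Im_add x y : complex.Im (x + y) = complex.Im x + complex.Im y.
Proof. by case: x; case: y. Qed.

Lemma Re_opp x : complex.Re (- x) = - complex.Re x. Proof. by case: x. Qed.
Lemma Im_opp x : complex.Im (- x) = - complex.Im x. Proof. by case: x. Qed.

Lemma Re_cj x : complex.Re (Num.conj x) = complex.Re x. Proof. by case: x. Qed.
Lemma Im_cj x : complex.Im (Num.conj x) = - complex.Im x. Proof. by case: x. Qed.

Lemma conjM x y : Num.conj (x * y) = Num.conj x * Num.conj y.
Proof. exact: rmorphM. Qed.

Lemma conjD x y : Num.conj (x + y) = Num.conj x + Num.conj y.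
Proof. exact: rmorphD. Qed.

Lemma conj_sum I (r : seq I) (P : pred I) (F : I -> C) :
  Num.conj (\sum_(i <- r | P i) F i) = \sum_(i <- r | P i) Num.conj (F i).
Proof. exact: rmorph_sum. Qed.

Lemma conj_invol x : Num.conj (Num.conj x) = x.
Proof. exact: conjCK. Qed.

Lemma Re_sum I (r : seq I) (P : pred I) (F : I -> C) :
  complex.Re (\sum_(i <- r | P i) F i) = \sum_(i <- r | P i) complex.Re (F i).
Proof. exact: (big_morph (@complex.Re R) Re_add). Qed.

Lemma Im_sum I (r : seq I) (P : pred I) (F : I -> C) :
  complex.Im (\sum_(i <- r | P i) F i) = \sum_(i <- r | P i) complex.Im (F i).
Proof. exact: (big_morph (@complex.Im R) Im_add). Qed.

Lemma complex_eq x y :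
  complex.Re x = complex.Re y -> complex.Im x = complex.Im y -> x = y.
Proof. by case: x; case: y => a b c d /= -> ->. Qed.

Lemma sqmodE z : (real_complex R (sqmod z)) = `|z| ^+ 2.
Proof. exact: add_Re2_Im2. Qed.

Lemma sqmod_mulJ z : z * Num.conj z = real_complex R (sqmod z).
Proof. by rewrite sqmodE normCK. Qed.

Lemma sqmod_ge0 z : 0 <= sqmod z.
Proof. by rewrite addr_ge0 ?sqr_ge0. Qed.

Lemma sqmod_eq0 z : sqmod z = 0 -> z = 0.
Proof.
by move=> h; apply/eqP; rewrite -normr_eq0 -sqrf_eq0 -sqmodE h.
Qed.

Lemma sqmod0 : sqmod 0 = 0. Proof. by rewrite /sqmod /= expr0n addr0. Qed.
Lemma sqmod1 : sqmod 1 = 1. Proof. by rewrite /sqmod /= expr0n expr1n addr0. Qed.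
Lemma sqmodN z : sqmod (- z) = sqmod z.
Proof. by rewrite /sqmod Re_opp Im_opp !sqrrN. Qed.
Lemma sqmodJ z : sqmod (Num.conj z) = sqmod z.
Proof. by rewrite /sqmod Re_cj Im_cj sqrrN. Qed.

Lemma sqmodM x y : sqmod (x * y) = sqmod x * sqmod y.
Proof. by rewrite /sqmod Re_mul Im_mul; ring. Qed.

Lemma sqmodX z n : sqmod (z ^+ n) = sqmod z ^+ n.
Proof. by elim: n => [|n IH]; rewrite ?expr0 ?sqmod1 // !exprS sqmodM IH. Qed.

Lemma sqmod_real t : sqmod (real_complex R t) = t ^+ 2.
Proof. by rewrite /sqmod /= expr0n addr0. Qed.

Lemma parallelogram x y :
  sqmod (x + y) + sqmod (x - y) = 2 * sqmod x + 2 * sqmod y.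
Proof. by rewrite /sqmod !Re_add !Im_add !Re_opp !Im_opp; ring. Qed.

Lemma sqmodD_le x y : sqmod (x + y) <= 2 * sqmod x + 2 * sqmod y.
Proof. by rewrite -parallelogram lerDl sqmod_ge0. Qed.

Lemma norm_lt1 z : (`|z| < 1) = (sqmod z < 1).
Proof.
by rewrite -(@expr_lt1 _ 2) // -sqmodE -[1]/(real_complex R 1) ltcR.
Qed.

Lemma norm_le1 z : (`|z| <= 1) = (sqmod z <= 1).
Proof.
by rewrite -(@expr_le1 _ 2) // -sqmodE -[1]/(real_complex R 1) lecR.
Qed.

End ComplexModulus.

Section ComplexLimits.
Context {R : realType}.
Local Notation C := R[i].
Implicit Types (u v : nat -> C) (l k : C).

Lemma cvgCP u l : cvgC u l <->
  (complex.Re (u n) @[n --> \oo] --> complex.Re l) /\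
  (complex.Im (u n) @[n --> \oo] --> complex.Im l).
Proof.
have normi : `|'i%C : C| = 1.
  by rewrite normc_def /= expr0n expr1n add0r sqrtr1.
have ReIm (z : C) (e : R) : `|z| <= real_complex R e ->
    `|complex.Re z| <= e /\ `|complex.Im z| <= e.
  move=> h; rewrite -!lecR; split; apply: le_trans h.
    exact: normc_ge_Re.
  rewrite -[complex.Im z]opprK normrN -ReiNIm; apply: le_trans (normc_ge_Re _) _.
  by rewrite normrM normi mulr1.
split.
- move=> /(@cvgrPdist_le C C^o) h; split; apply/cvgrPdist_le => e e0.
  + have := h (real_complex R e); rewrite ltcR => /(_ e0).
    apply: filterS => n /= /ReIm [+ _]; by rewrite Re_add Re_opp.
  + have := h (real_complex R e); rewrite ltcR => /(_ e0).
    apply: filterS => n /= /ReIm [_ +]; by rewrite Im_add Im_opp.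
- move=> [/cvgrPdist_le hr /cvgrPdist_le hi].
  (* A positive element of [R[i]] has zero imaginary part, so the tolerance is real. *)
  apply/(@cvgrPdist_le C C^o) => -[e e'] /=; rewrite ltcE /= => /andP[/eqP -> e0].
  have e2 : 0 < e / 2 by rewrite divr_gt0.
  near=> n.
  have h1 : `|complex.Re l - complex.Re (u n)| <= e / 2 by near: n; exact: hr.
  have h2 : `|complex.Im l - complex.Im (u n)| <= e / 2 by near: n; exact: hi.
  rewrite [X in `|X|]complexE; apply: le_trans (ler_normD _ _) _.
  rewrite normrM normi mul1r Re_add Re_opp Im_add Im_opp !normc_def /= !expr0n !addr0 !sqrtr_sqr.
  by rewrite -[(e +i* 0)%C]/(real_complex R e) -rmorphD /= lecR (splitr e) lerD.
Unshelve. all: by end_near. Qed.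

Lemma limCE u l : cvgC u l -> limC u = l.
Proof.
by move=> h; apply: (@cvg_lim C^o) h; exact: (@norm_hausdorff C C^o).
Qed.

Lemma cvgC_cst l : cvgC (fun=> l) l.
Proof. by apply/cvgCP; split; exact: cvg_cst. Qed.

Lemma cvgCD u v l k : cvgC u l -> cvgC v k -> cvgC (fun n => u n + v n) (l + k).
Proof.
move=> /cvgCP[a b] /cvgCP[c d]; apply/cvgCP; rewrite Re_add Im_add; split.
- by under eq_fun do rewrite Re_add; exact: cvgD.
- by under eq_fun do rewrite Im_add; exact: cvgD.
Qed.

Lemma cvgCM u v l k : cvgC u l -> cvgC v k -> cvgC (fun n => u n * v n) (l * k).
Proof.
move=> /cvgCP[a b] /cvgCP[c d]; apply/cvgCP; rewrite Re_mul Im_mul; split.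
- by under eq_fun do rewrite Re_mul; apply: cvgB; apply: cvgM.
- by under eq_fun do rewrite Im_mul; apply: cvgD; apply: cvgM.
Qed.

Lemma cvgCJ u l : cvgC u l -> cvgC (fun n => Num.conj (u n)) (Num.conj l).
Proof.
move=> /cvgCP[a b]; apply/cvgCP; rewrite Re_cj Im_cj; split.
- by under eq_fun do rewrite Re_cj.
- by under eq_fun do rewrite Im_cj; exact: cvgN.
Qed.

Lemma cvgC_sum I (r : seq I) (P : pred I) (F : I -> nat -> C) (L : I -> C) :
  (forall i, P i -> cvgC (F i) (L i)) ->
  cvgC (fun n => \sum_(i <- r | P i) F i n) (\sum_(i <- r | P i) L i).
Proof.
move=> h; elim: r => [|i r IH].
  by under eq_fun do rewrite big_nil; rewrite big_nil; exact: cvgC_cst.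
rewrite big_cons; under eq_fun do rewrite big_cons.
case: ifP => Pi; last exact: IH.
by apply: cvgCD; [exact: h|exact: IH].
Qed.

Lemma cvgR_sum I (r : seq I) (F : I -> nat -> R) (L : I -> R) :
  (forall i, F i n @[n --> \oo] --> L i) ->
  (\sum_(i <- r) F i n) @[n --> \oo] --> \sum_(i <- r) L i.
Proof.
move=> h; elim: r => [|i r IH].
  by under eq_fun do rewrite big_nil; rewrite big_nil; exact: cvg_cst.
rewrite big_cons; under eq_fun do rewrite big_cons.
by apply: cvgD; [exact: h|exact: IH].
Qed.

Lemma cvgC_real (u : nat -> R) (l : R) : u n @[n --> \oo] --> l ->
  cvgC (fun n => real_complex R (u n)) (real_complex R l).
Proof. by move=> h; apply/cvgCP; split => //=; exact: cvg_cst. Qed.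

Lemma cvg_sqmod u l : cvgC u l -> sqmod (u n) @[n --> \oo] --> sqmod l.
Proof.
move=> /cvgCP[a b]; have h := cvgD (cvgM a a) (cvgM b b).
have -> : (fun n => sqmod (u n)) = (fun n =>
    complex.Re (u n) * complex.Re (u n) + complex.Im (u n) * complex.Im (u n)).
  by apply/funext => n; rewrite /sqmod !expr2.
rewrite /sqmod !expr2; exact: h.
Qed.

Lemma cvgC_sqmod u l : sqmod (u n - l) @[n --> \oo] --> (0 : R) -> cvgC u l.
Proof.
move=> /cvgrPdist_lt h; apply/cvgCP; split; apply/cvgrPdist_lt => e e0.
- have := h _ (exprn_gt0 2 e0); apply: filterS => n /=.
  rewrite sub0r normrN ger0_norm ?sqmod_ge0 // /sqmod Re_add Re_opp => le1.
  have : `|complex.Re l - complex.Re (u n)| ^+ 2 < e ^+ 2.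
    rewrite real_normK ?num_real //; apply: le_lt_trans le1.
    by rewrite -sqrrN opprB lerDl sqr_ge0.
  by rewrite ltr_pXn2r // nnegrE ?normr_ge0 // ltW.
- have := h _ (exprn_gt0 2 e0); apply: filterS => n /=.
  rewrite sub0r normrN ger0_norm ?sqmod_ge0 // /sqmod Im_add Im_opp => le1.
  have : `|complex.Im l - complex.Im (u n)| ^+ 2 < e ^+ 2.
    rewrite real_normK ?num_real //; apply: le_lt_trans le1.
    by rewrite -sqrrN opprB lerDr sqr_ge0.
  by rewrite ltr_pXn2r // nnegrE ?normr_ge0 // ltW.
Qed.

End ComplexLimits.
Arguments cvgC_cst {R} l.


(** * The Hilbert space of square-summable arrays *)

Section Hardy.
Context {R : realType}.
Local Notation C := R[i].
Implicit Types (f g h : ps2 R) (a : C) (N : nat).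

Definition psum N f : R := \sum_(i < N) \sum_(j < N) sqmod (f i j).
Definition psip N f g : C := \sum_(i < N) \sum_(j < N) f i j * Num.conj (g i j).
Definition nsq f : R := limn (psum ^~ f).
(** The shape [a * f + g] is the one required by [closed_subspace]; differences, scalar multiples
    and finite sums are all reduced to it. *)
Definition psl a f g : ps2 R := fun i j => a * f i j + g i j.

Lemma psum_ge0 N f : 0 <= psum N f.
Proof. by apply: sumr_ge0 => i _; apply: sumr_ge0 => j _; exact: sqmod_ge0. Qed.

Lemma leq_sum_ord (F : nat -> R) (m n : nat) : (m <= n)%N ->
  (forall i, 0 <= F i) -> \sum_(i < m) F i <= \sum_(i < n) F i.
Proof.
move=> mn F0; rewrite -(subnKC mn) big_split_ord /= lerDl.
by apply: sumr_ge0.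
Qed.

Lemma psum_mono f : {homo psum ^~ f : m n / (m <= n)%N >-> m <= n}.
Proof.
move=> m n mn; rewrite /psum.
apply: (@le_trans _ _ (\sum_(i < m) \sum_(j < n) sqmod (f i j))).
  apply: ler_sum => i _.
  by apply: (@leq_sum_ord (fun j => sqmod (f i j))) => // j; exact: sqmod_ge0.
apply: (@leq_sum_ord (fun i => \sum_(j < n) sqmod (f i j))) => // i.
by apply: sumr_ge0 => j _; exact: sqmod_ge0.
Qed.

Lemma psum_term N f i j : (i < N)%N -> (j < N)%N -> sqmod (f i j) <= psum N f.
Proof.
move=> iN jN; rewrite /psum (bigD1 (Ordinal iN)) //= (bigD1 (Ordinal jN)) //=.
rewrite -addrA lerDl addr_ge0 //; first by apply: sumr_ge0 => k _; exact: sqmod_ge0.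
by apply: sumr_ge0 => k _; apply: sumr_ge0 => l _; exact: sqmod_ge0.
Qed.

Lemma inH2P f : inH2 f <-> exists M : R, forall N, psum N f <= M.
Proof.
have E N : real_complex R (psum N f) = \sum_(i < N) \sum_(j < N) `|f i j| ^+ 2.
  rewrite /psum rmorph_sum /=; apply: eq_bigr => i _.
  by rewrite rmorph_sum /=; apply: eq_bigr => j _; rewrite sqmodE.
split=> [[[M M'] h]|[M h]].
- by exists M => N; have := h N; rewrite -E lecE /= => /andP[].
- by exists (real_complex R M) => N; rewrite -E lecR.
Qed.

Lemma psum_cvg f : inH2 f -> psum N f @[N --> \oo] --> nsq f.
Proof.
move=> /inH2P[M h]; apply: (@nondecreasing_is_cvgn _ (psum ^~ f)).
  exact: psum_mono.
by exists M => _ [N _ <-].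
Qed.

Lemma psum_le_nsq N f : inH2 f -> psum N f <= nsq f.
Proof.
move=> /psum_cvg fH; apply: (@nondecreasing_cvgn_le _ (psum ^~ f)).
  exact: psum_mono.
by apply: cvgP fH.
Qed.

Lemma nsq_ge0 f : inH2 f -> 0 <= nsq f.
Proof. by move=> /(psum_le_nsq 0); apply: le_trans; exact: psum_ge0. Qed.

Lemma nsq_le f M : (forall N, psum N f <= M) -> inH2 f /\ nsq f <= M.
Proof.
move=> h; have fH : inH2 f by apply/inH2P; exists M.
split=> //; apply: limr_le.
  by apply: cvgP (psum_cvg fH).
by apply: nearW.
Qed.

Lemma nsq_term f i j : inH2 f -> sqmod (f i j) <= nsq f.
Proof.
move=> fH; apply: le_trans (psum_le_nsq (maxn i j).+1 fH).
by apply: psum_term; rewrite ltnS ?leq_maxl ?leq_maxr.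
Qed.

Lemma nsq_eq0 f : inH2 f -> nsq f <= 0 -> f = @ps_zero R.
Proof.
move=> fH f0; apply/funext => i; apply/funext => j.
apply: sqmod_eq0; apply/eqP; rewrite eq_le sqmod_ge0 andbT.
exact: le_trans (nsq_term i j fH) f0.
Qed.

Lemma psum_psl N a f g :
  psum N (psl a f g) <= 2 * sqmod a * psum N f + 2 * psum N g.
Proof.
rewrite /psum !mulr_sumr -big_split /=; apply: ler_sum => i _.
rewrite !mulr_sumr -big_split /=; apply: ler_sum => j _.
by apply: le_trans (sqmodD_le _ _) _; rewrite sqmodM mulrA.
Qed.

Lemma inH2_psl a f g : inH2 f -> inH2 g -> inH2 (psl a f g).
Proof.
move=> fH gH; apply/inH2P; exists (2 * sqmod a * nsq f + 2 * nsq g) => N.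
apply: le_trans (psum_psl _ _ _ _) _; apply: lerD; apply: ler_wpM2l.
- by rewrite mulr_ge0 ?sqmod_ge0.
- exact: psum_le_nsq.
- by [].
- exact: psum_le_nsq.
Qed.

Lemma inH2_zero : inH2 (@ps_zero R).
Proof.
by apply/inH2P; exists 0 => N; rewrite /psum big1 // => i _; rewrite big1 // => j _; rewrite sqmod0.
Qed.

Lemma ps_subE f g : ps_sub f g = psl (-1) g f.
Proof. by apply/funext => i; apply/funext => j; rewrite /ps_sub /psl mulN1r addrC. Qed.

Lemma ps_addE f g : ps_add f g = psl 1 f g.
Proof. by apply/funext => i; apply/funext => j; rewrite /ps_add /psl mul1r. Qed.

Lemma inH2_sub f g : inH2 f -> inH2 g -> inH2 (ps_sub f g).
Proof. by move=> fH gH; rewrite ps_subE; exact: inH2_psl. Qed.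

(** Polarization on finite blocks writes the partial sums of [ip] through four monotone bounded
    ones, which is how the limit defining [ip] is shown to exist. *)
Lemma psip_polar N f g : psip N f g = Complex
  ((psum N (psl 1 g f) - psum N (psl (-1) g f)) / 4)
  ((psum N (psl (Complex 0 1) g f) - psum N (psl (- Complex 0 1) g f)) / 4).
Proof.
have key (x y : C) : x * Num.conj y = Complex
    ((sqmod (1 * y + x) - sqmod (-1 * y + x)) / 4)
    ((sqmod (Complex 0 1 * y + x) - sqmod (- Complex 0 1 * y + x)) / 4).
  case: x => a b; case: y => c d; rewrite conjE; apply: complex_eq.
    by rewrite Re_mul /sqmod !Re_add !Im_add !Re_mul !Im_mul !Re_opp !Im_opp /=; field.
  by rewrite Im_mul /sqmod !Re_add !Im_add !Re_mul !Im_mul !Re_opp !Im_opp /=; field.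
apply: complex_eq.
- rewrite Re_sum /= /psum -sumrB mulr_suml; apply: eq_bigr => i _.
  by rewrite Re_sum -sumrB mulr_suml; apply: eq_bigr => j _; rewrite key.
- rewrite Im_sum /= /psum -sumrB mulr_suml; apply: eq_bigr => i _.
  by rewrite Im_sum -sumrB mulr_suml; apply: eq_bigr => j _; rewrite key.
Qed.

Definition polar f g : C := Complex
  ((nsq (psl 1 g f) - nsq (psl (-1) g f)) / 4)
  ((nsq (psl (Complex 0 1) g f) - nsq (psl (- Complex 0 1) g f)) / 4).

Lemma psip_cvg_polar f g : inH2 f -> inH2 g -> cvgC (fun N => psip N f g) (polar f g).
Proof.
move=> fH gH; apply/cvgCP; split.
- under eq_fun do rewrite psip_polar; apply: cvgM; last exact: cvg_cst.
  by apply: cvgB; apply: psum_cvg; apply: inH2_psl.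
- under eq_fun do rewrite psip_polar; apply: cvgM; last exact: cvg_cst.
  by apply: cvgB; apply: psum_cvg; apply: inH2_psl.
Qed.

Lemma ipE f g : inH2 f -> inH2 g -> ip f g = polar f g.
Proof. by move=> fH gH; apply: limCE; exact: psip_cvg_polar. Qed.

Lemma psip_cvg f g : inH2 f -> inH2 g -> cvgC (fun N => psip N f g) (ip f g).
Proof. by move=> fH gH; rewrite ipE //; exact: psip_cvg_polar. Qed.

Lemma ip_psl a f g h : inH2 f -> inH2 g -> inH2 h ->
  ip (psl a f g) h = a * ip f h + ip g h.
Proof.
move=> fH gH hH; apply: limCE.
have := cvgCD (cvgCM (cvgC_cst a) (psip_cvg fH hH)) (psip_cvg gH hH).
congr (cvgC _ _); apply/funext => N.
rewrite /psip mulr_sumr -big_split /=; apply: eq_bigr => i _.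
rewrite mulr_sumr -big_split /=; apply: eq_bigr => j _.
by rewrite /psl mulrDl mulrA.
Qed.

Lemma ip_conj f g : inH2 f -> inH2 g -> ip g f = Num.conj (ip f g).
Proof.
move=> fH gH; apply: limCE.
have := cvgCJ (psip_cvg fH gH); congr (cvgC _ _); apply/funext => N.
rewrite /psip conj_sum /=; apply: eq_bigr => i _.
rewrite conj_sum /=; apply: eq_bigr => j _.
by rewrite conjM conj_invol mulrC.
Qed.

Lemma ip_pslr a f g h : inH2 f -> inH2 g -> inH2 h ->
  ip h (psl a f g) = Num.conj a * ip h f + ip h g.
Proof.
move=> fH gH hH; rewrite ip_conj ?ip_psl //; last exact: inH2_psl.
by rewrite conjD conjM -!ip_conj.
Qed.

Lemma ip_self f : inH2 f -> ip f f = real_complex R (nsq f).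
Proof.
move=> fH; apply: limCE; have := cvgC_real (psum_cvg fH).
congr (cvgC _ _); apply/funext => N.
rewrite /psip /psum rmorph_sum; apply: eq_bigr => i _ /=.
by rewrite rmorph_sum; apply: eq_bigr => j _ /=; rewrite sqmod_mulJ.
Qed.

Lemma ip_zerol g : ip (@ps_zero R) g = 0.
Proof.
apply: limCE; have := cvgC_cst (0 : C); congr (cvgC _ _); apply/funext => N.
by rewrite big1 // => i _; rewrite big1 // => j _; rewrite mul0r.
Qed.

Lemma ip_sub f g h : inH2 f -> inH2 g -> inH2 h ->
  ip (ps_sub f g) h = ip f h - ip g h.
Proof. by move=> fH gH hH; rewrite ps_subE ip_psl // mulN1r addrC. Qed.

Lemma nsq_psl a f g : inH2 f -> inH2 g ->
  nsq (psl a f g) = sqmod a * nsq f + 2 * complex.Re (a * ip f g) + nsq g.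
Proof.
move=> fH gH; apply: (@complexI R).
rewrite -ip_self; last exact: inH2_psl.
rewrite ip_psl ?ip_pslr //; try exact: inH2_psl.
rewrite !ip_self // [ip g f]ip_conj //.
move: (ip f g) (nsq f) (nsq g) => -[x y] s t; case: a => a b.
rewrite !conjE /sqmod; apply: complex_eq.
- by rewrite !Re_add !Re_mul !Re_add !Im_add !Re_mul !Im_mul /=; ring.
- by rewrite !Im_add !Im_mul !Re_add !Im_add !Re_mul !Im_mul /=; ring.
Qed.

(* A weak Cauchy-Schwarz inequality, without square roots or a case [nsq g = 0]. *)
Lemma ip_bound f g : inH2 f -> inH2 g -> sqmod (ip f g) <= (nsq g + 1) * nsq f.
Proof.
move=> fH gH; set c := ip f g; set G := nsq g + 1.
have g0 := nsq_ge0 gH; have G0 : 0 < G by rewrite ltr_wpDl.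
have s0 := sqmod_ge0 c.
(* The test vector is [f - (c / G) g]: the usual one of Cauchy-Schwarz with [nsq g] replaced by the
   positive number [G = nsq g + 1]. *)
have := nsq_ge0 (inH2_psl (real_complex R (- G^-1) * c) gH fH).
rewrite nsq_psl // [ip g f]ip_conj // -/c sqmodM sqmod_real.
rewrite -(mulrA _ c (Num.conj c)) sqmod_mulJ.
rewrite -rmorphM /= sqrrN => H.
have e : G^-1 * G = 1 by rewrite mulVf // lt0r_neq0.
have t0 : 0 < G^-1 by rewrite invr_gt0.
have tn : G^-1 * nsq g = 1 - G^-1 by rewrite -e /G mulrDr mulr1 addrK.
have {H}H : G^-1 * sqmod c <= nsq f.
  have : G^-1 ^+ 2 * sqmod c * nsq g = G^-1 * sqmod c * (1 - G^-1).
    by rewrite -tn; ring.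
  by nra.
by rewrite -ler_pdivrMl.
Qed.

Lemma psum_cvg_pointwise N (u : nat -> ps2 R) f :
  (forall i j, cvgC (fun k => u k i j) (f i j)) ->
  psum N (u k) @[k --> \oo] --> psum N f.
Proof.
move=> h; rewrite /psum; apply: cvgR_sum => i; apply: cvgR_sum => j.
exact: cvg_sqmod.
Qed.

(** Entrywise limits respect bounds on a fixed block; letting [N] grow through [nsq_le] turns this
    into Fatou's lemma for the norm. *)
Lemma psum_fatou (u : nat -> ps2 R) f (b : nat -> R) (c : R) N :
  (forall i j, cvgC (fun k => u k i j) (f i j)) ->
  (\forall k \near \oo, psum N (u k) <= b k) ->
  b k @[k --> \oo] --> c -> psum N f <= c.
Proof.
move=> h hb bc; have hp := psum_cvg_pointwise (N := N) h.
rewrite -(cvg_lim (@Rhausdorff R) hp) -(cvg_lim (@Rhausdorff R) bc).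
by apply: ler_lim => //; [apply: cvgP hp|apply: cvgP bc].
Qed.

Definition ncvg (u : nat -> ps2 R) f :=
  nsq (ps_sub (u k) f) @[k --> \oo] --> (0 : R).

Lemma ip_ncvg (u : nat -> ps2 R) f g : (forall k, inH2 (u k)) -> inH2 f ->
  inH2 g -> ncvg u f -> cvgC (fun k => ip (u k) g) (ip f g).
Proof.
move=> uH fH gH uf; apply: cvgC_sqmod.
have hz : (nsq g + 1) * nsq (ps_sub (u k) f) @[k --> \oo] --> (0 : R).
  by rewrite -(mulr0 (nsq g + 1)); apply: cvgM uf; exact: cvg_cst.
apply: (squeeze_cvgr _ (cvg_cst 0) hz).
apply: nearW => k; rewrite sqmod_ge0 /= -ip_sub //; apply: ip_bound => //.
exact: inH2_sub.
Qed.

Lemma closed_ncvg (S : set (ps2 R)) (u : nat -> ps2 R) f : closed_subspace S ->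
  (forall k, S (u k)) -> inH2 f -> ncvg u f -> S f.
Proof.
move=> [SH _ _ Scl] Su fH uf; apply: (Scl u) => //.
have := cvgC_real uf; congr (cvgC _ _); apply/funext => k.
by rewrite ip_self //; apply: inH2_sub => //; exact: SH.
Qed.

Lemma closed_psl (S : set (ps2 R)) a f g : closed_subspace S ->
  S f -> S g -> S (psl a f g).
Proof. by move=> [_ _ + _]; exact. Qed.

Lemma closed_sub (S : set (ps2 R)) f g : closed_subspace S ->
  S f -> S g -> S (ps_sub f g).
Proof. by move=> Scl Sf Sg; rewrite ps_subE; exact: closed_psl. Qed.

Definition pssum I (r : seq I) (F : I -> ps2 R) : ps2 R :=
  fun i j => \sum_(k <- r) F k i j.

Lemma pssum_cons I (k : I) (r : seq I) F : @pssum I (k :: r) F = psl 1 (F k) (pssum r F).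
Proof. by apply/funext => i; apply/funext => j; rewrite /pssum big_cons /psl mul1r. Qed.

Lemma pssum_nil I F : @pssum I [::] F = @ps_zero R.
Proof. by apply/funext => i; apply/funext => j; rewrite /pssum big_nil. Qed.

Lemma inH2_pssum I (r : seq I) F : (forall k, inH2 (F k)) -> inH2 (pssum r F).
Proof.
move=> FH; elim: r => [|k r IH]; first by rewrite pssum_nil; exact: inH2_zero.
by rewrite pssum_cons; exact: inH2_psl.
Qed.

Lemma closed_pssum (S : set (ps2 R)) I (r : seq I) F : closed_subspace S ->
  (forall k, S (F k)) -> S (pssum r F).
Proof.
move=> Scl FH; elim: r => [|k r IH]; first by rewrite pssum_nil; case: Scl.
by rewrite pssum_cons; exact: closed_psl.
Qed.

Lemma ip_pssum I (r : seq I) F g : (forall k, inH2 (F k)) -> inH2 g ->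
  ip (pssum r F) g = \sum_(k <- r) ip (F k) g.
Proof.
move=> FH gH; elim: r => [|k r IH]; first by rewrite pssum_nil ip_zerol big_nil.
by rewrite pssum_cons ip_psl ?IH ?big_cons ?mul1r //; exact: inH2_pssum.
Qed.

Definition back1 f : ps2 R := fun i j => f i.+1 j.

Lemma psum_shift1 N f : psum N (shift1 f) <= psum N f <= psum N.+1 (shift1 f).
Proof.
apply/andP; split.
- case: N => [|N]; first by rewrite /psum !big_ord0.
  rewrite /psum big_ord_recl /= big1 ?add0r; last by move=> j _; rewrite sqmod0.
  rewrite [leRHS]big_ord_recr /= lerDl.
  by apply: sumr_ge0 => j _; exact: sqmod_ge0.
- rewrite /psum [leRHS]big_ord_recl /= [X in _ <= X + _]big1 ?add0r; last first.
    by move=> j _; rewrite sqmod0.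
  apply: ler_sum => i _; apply: (@leq_sum_ord (fun j => sqmod (f i j))) => // j.
  exact: sqmod_ge0.
Qed.

Lemma psum_shift2 N f : psum N (shift2 f) <= psum N f <= psum N.+1 (shift2 f).
Proof.
apply/andP; split.
- case: N => [|N]; first by rewrite /psum !big_ord0.
  apply: ler_sum => i _; rewrite big_ord_recl /= sqmod0 add0r.
  by rewrite [leRHS]big_ord_recr /= lerDl sqmod_ge0.
- rewrite /psum [leRHS]big_ord_recr /= -[leLHS]addr0; apply: lerD.
    by apply: ler_sum => i _; rewrite [leRHS]big_ord_recl /= sqmod0 add0r.
  by apply: sumr_ge0 => j _; exact: sqmod_ge0.
Qed.

(** A shift moves each [N]-block into the next larger one, so the partial sums of [f] and [s f]
    interlace and have the same limit. One argument serves both variables. *)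
Lemma nsq_sandwich (s : ps2 R -> ps2 R) f :
  (forall N g, psum N (s g) <= psum N g <= psum N.+1 (s g)) ->
  inH2 f -> inH2 (s f) /\ nsq (s f) = nsq f.
Proof.
move=> hs fH; have [sH le1] : inH2 (s f) /\ nsq (s f) <= nsq f.
  apply: nsq_le => N; case/andP: (hs N f) => h _.
  exact: le_trans h (psum_le_nsq _ fH).
split=> //; apply/eqP; rewrite eq_le le1 /=.
apply: (proj2 (@nsq_le f _ _)) => N; case/andP: (hs N f) => _ h.
exact: le_trans h (psum_le_nsq _ sH).
Qed.

Lemma inH2_shift1 f : inH2 f -> inH2 (shift1 f).
Proof. by move=> fH; case: (nsq_sandwich psum_shift1 fH). Qed.

Lemma inH2_shift2 f : inH2 f -> inH2 (shift2 f).
Proof. by move=> fH; case: (nsq_sandwich psum_shift2 fH). Qed.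

Lemma nsq_shift1 f : inH2 f -> nsq (shift1 f) = nsq f.
Proof. by move=> fH; case: (nsq_sandwich psum_shift1 fH). Qed.

Lemma nsq_shift2 f : inH2 f -> nsq (shift2 f) = nsq f.
Proof. by move=> fH; case: (nsq_sandwich psum_shift2 fH). Qed.

Lemma shift1_psl a f g : shift1 (psl a f g) = psl a (shift1 f) (shift1 g).
Proof. by apply/funext => -[|i]; apply/funext => j; rewrite /psl /= ?mulr0 ?addr0. Qed.

Lemma shift2_psl a f g : shift2 (psl a f g) = psl a (shift2 f) (shift2 g).
Proof. by apply/funext => i; apply/funext => -[|j]; rewrite /psl /= ?mulr0 ?addr0. Qed.

(** Partial sums of inner products do not interlace, so the isometry is carried over from norms by
    polarization. *)
Lemma ip_shift1 f g : inH2 f -> inH2 g -> ip (shift1 f) (shift1 g) = ip f g.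
Proof.
move=> fH gH; rewrite !ipE //; try exact: inH2_shift1.
by rewrite /polar -!shift1_psl !nsq_shift1 //; exact: inH2_psl.
Qed.

Lemma ip_shift2 f g : inH2 f -> inH2 g -> ip (shift2 f) (shift2 g) = ip f g.
Proof.
move=> fH gH; rewrite !ipE //; try exact: inH2_shift2.
by rewrite /polar -!shift2_psl !nsq_shift2 //; exact: inH2_psl.
Qed.

Lemma inH2_back1 f : inH2 f -> inH2 (back1 f).
Proof.
move=> fH; apply: (proj1 (@nsq_le _ (nsq f) _)) => N.
apply: le_trans (psum_le_nsq N.+1 fH).
rewrite /psum [leRHS]big_ord_recl /= -[leLHS]add0r; apply: lerD.
  by apply: sumr_ge0 => j _; exact: sqmod_ge0.
apply: ler_sum => i _; apply: (@leq_sum_ord (fun j => sqmod (f i.+1 j))) => // j.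
exact: sqmod_ge0.
Qed.

(** [shift1 (back1 f)] differs from [f] only in row [0], where [shift1 g] vanishes; the rest is the
    isometry of [shift1]. *)
Lemma ip_back1 f g : inH2 f -> inH2 g -> ip (back1 f) g = ip f (shift1 g).
Proof.
move=> fH gH; have bH := inH2_back1 fH; have sH := inH2_shift1 gH.
have sbH := inH2_shift1 bH.
rewrite -ip_shift1 //; apply/eqP; rewrite -subr_eq0 -ip_sub //; apply/eqP.
apply: limCE; have := cvgC_cst (0 : C); congr (cvgC _ _); apply/funext => N.
rewrite big1 // => -[[|i] /= iN] _; rewrite big1 // => j _ /=.
  by rewrite rmorph0 mulr0.
by rewrite /ps_sub /= /back1 subrr mul0r.
Qed.

End Hardy.


(** * Formal power series *)

Section PowerSeries.
Context {R : realType}.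
Local Notation C := R[i].
Implicit Types (f g h : ps2 R) (p q : poly2 R) (i j K : nat).

(** A coefficient of a Cauchy product depends only on truncations of the factors, so the ring laws
    of power series are inherited from the ring [poly2]. *)
Definition ptrunc K f : poly2 R := \poly_(i < K) \poly_(j < K) f i j.

Lemma coef2_ptrunc K f i j :
  coef2 (ptrunc K f) i j = if (i < K)%N && (j < K)%N then f i j else 0.
Proof.
rewrite /coef2 /ptrunc coef_poly; case: ltnP => // _ /=; last by rewrite coef0.
by rewrite coef_poly.
Qed.

Lemma coef2M p q : coef2 (p * q) = ps_mul (coef2 p) (coef2 q).
Proof.
apply/funext => i; apply/funext => j; rewrite /coef2 /ps_mul coefM coef_sum.
by apply: eq_bigr => a _; rewrite coefM.
Qed.

Lemma coef2D p q i j : coef2 (p + q) i j = coef2 p i j + coef2 q i j.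
Proof. by rewrite /coef2 !coefD. Qed.

Lemma coef2B p q i j : coef2 (p - q) i j = coef2 p i j - coef2 q i j.
Proof. by rewrite /coef2 !coefB. Qed.

Lemma ps_mul_agree f g f' g' i j :
  (forall a b, (a <= i)%N -> (b <= j)%N -> f a b = f' a b) ->
  (forall a b, (a <= i)%N -> (b <= j)%N -> g a b = g' a b) ->
  ps_mul f g i j = ps_mul f' g' i j.
Proof.
move=> hf hg; apply: eq_bigr => -[a /=]; rewrite ltnS => ai _.
apply: eq_bigr => -[b /=]; rewrite ltnS => bj _.
by rewrite hf // hg // leq_subr.
Qed.

Lemma ps_mul_trunc K f g i j : (i < K)%N -> (j < K)%N ->
  ps_mul f g i j = coef2 (ptrunc K f * ptrunc K g) i j.
Proof.
move=> iK jK; rewrite coef2M; apply: ps_mul_agree => a b ai bj;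
  by rewrite coef2_ptrunc (leq_ltn_trans ai iK) (leq_ltn_trans bj jK).
Qed.

Lemma ps_mulC f g : ps_mul f g = ps_mul g f.
Proof.
apply/funext => i; apply/funext => j.
have [hi hj] : (i < (maxn i j).+1)%N /\ (j < (maxn i j).+1)%N.
  by rewrite !ltnS leq_maxl leq_maxr.
by rewrite !(ps_mul_trunc _ _ hi hj) mulrC.
Qed.

Lemma ps_mulA f g h : ps_mul f (ps_mul g h) = ps_mul (ps_mul f g) h.
Proof.
apply/funext => i; apply/funext => j; set K := (maxn i j).+1.
have [hi hj] : (i < K)%N /\ (j < K)%N by rewrite !ltnS leq_maxl leq_maxr.
have tr u a b : (a <= i)%N -> (b <= j)%N -> u a b = coef2 (ptrunc K u) a b.
  by move=> ai bj; rewrite coef2_ptrunc (leq_ltn_trans ai hi) (leq_ltn_trans bj hj).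
transitivity (coef2 (ptrunc K f * (ptrunc K g * ptrunc K h)) i j).
  rewrite coef2M; apply: ps_mul_agree; first exact: tr.
  move=> a b ai bj; apply: ps_mul_trunc; first exact: leq_ltn_trans hi.
  exact: leq_ltn_trans hj.
rewrite mulrA coef2M; apply: ps_mul_agree; last by move=> a b ai bj; rewrite -tr.
move=> a b ai bj; apply/esym/ps_mul_trunc; first exact: leq_ltn_trans hi.
exact: leq_ltn_trans hj.
Qed.

Lemma ps_mul_psl (a : C) f g h :
  ps_mul f (psl a g h) = psl a (ps_mul f g) (ps_mul f h).
Proof.
apply/funext => i; apply/funext => j; rewrite /psl /ps_mul mulr_sumr -big_split /=.
apply: eq_bigr => k _; rewrite mulr_sumr -big_split /=.
by apply: eq_bigr => l _; rewrite mulrDr mulrCA.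
Qed.

Lemma ps_mul_sum f I (r : seq I) F :
  ps_mul f (pssum r F) = pssum r (fun k => ps_mul f (F k)).
Proof.
elim: r => [|k r IH]; last by rewrite !pssum_cons ps_mul_psl IH.
rewrite !pssum_nil; apply/funext => i; apply/funext => j.
by rewrite /ps_mul big1 // => a _; rewrite big1 // => b _; rewrite mulr0.
Qed.

Lemma ps_mul_shift1 f g : ps_mul f (shift1 g) = shift1 (ps_mul f g).
Proof.
apply/funext => -[|i]; apply/funext => j; rewrite /ps_mul /=.
  by rewrite big1 // => a _; rewrite big1 // => b _; rewrite mulr0.
rewrite big_ord_recr /= subnn [X in _ + X]big1 ?addr0; last first.
  by move=> b _; rewrite mulr0.
apply: eq_bigr => -[a /=]; rewrite ltnS => ai _.
by apply: eq_bigr => b _; rewrite subSn.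
Qed.

Definition ps_one : ps2 R := coef2 1.

Lemma coef2C (x : C) i j :
  coef2 (x%:P%:P : poly2 R) i j = if (i == 0%N) && (j == 0%N) then x else 0.
Proof. rewrite /coef2 coefC; case: (i == 0%N); last by rewrite coef0.
rewrite coefC; case: (j == 0%N); by []. Qed.

Lemma ps_oneE i j : ps_one i j = if (i == 0%N) && (j == 0%N) then 1 else 0.
Proof. exact: coef2C. Qed.

Lemma ps_mul1 f : ps_mul ps_one f = f.
Proof.
apply/funext => i; apply/funext => j; rewrite /ps_mul (bigD1 ord0) //=.
rewrite [X in _ + X]big1 ?addr0; last first.
  move=> a a0; rewrite big1 // => b _; rewrite ps_oneE.
  by rewrite (negbTE (_ : (a : nat) != 0%N)) ?mul0r //; case: a a0 => -[].
rewrite (bigD1 ord0) //= big1 ?addr0; last first.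
  by move=> b b0; rewrite ps_oneE (negbTE (_ : (b : nat) != 0%N)) ?mul0r //; case: b b0 => -[].
by rewrite ps_oneE mul1r !subn0.
Qed.

Lemma coef2_exp_low p k i j : coef2 p 0 0 = 0 -> (i + j < k)%N ->
  coef2 (p ^+ k) i j = 0.
Proof.
move=> p0; elim: k i j => // k IH i j ijk; rewrite exprS coef2M.
rewrite /ps_mul big1 // => -[a /= ai] _; rewrite big1 // => -[b /= bj] _.
rewrite !ltnS in ai bj.
have [ab0|ab] := posnP (a + b)%N.
  by move/eqP: ab0; rewrite addn_eq0 => /andP[/eqP -> /eqP ->]; rewrite p0 mul0r.
by rewrite IH ?mulr0 //; lia.
Qed.

(* Geometric series in the nonconstant part. *)
Lemma ps_inv p : coef2 p 0 0 != 0 -> exists u, ps_mul (coef2 p) u = ps_one.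
Proof.
move=> p0; have [c cE] : exists c : poly2 R, coef2 c 0 0 = (coef2 p 0 0)^-1.
  by exists ((coef2 p 0 0)^-1)%:P%:P; rewrite coef2C.
have B1 q i j : coef2 (1 - q) i j = ps_one i j - coef2 q i j by exact: coef2B.
have [w wE] : exists w, w = 1 - c * p by exists (1 - c * p).
have w0 : coef2 w 0 0 = 0.
  rewrite wE B1 coef2M /ps_mul !big_ord_recl !big_ord0 !addr0 ps_oneE.
  by rewrite cE subn0 mulVf // subrr.
(* [w ^+ k] has no term of total degree below [k], so entry [(i, j)] of the infinite series is
   already that of its first [i + j + 1] terms. *)
pose u i j := coef2 (c * \sum_(k < (i + j).+1) w ^+ k) i j.
have uE n i j : (i + j < n)%N -> u i j = coef2 (c * \sum_(k < n) w ^+ k) i j.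
  move=> ijn; rewrite -(subnKC ijn) big_split_ord /= mulrDr coef2D.
  rewrite [X in _ + X](_ : _ = 0) ?addr0 // mulr_sumr /coef2 !coef_sum.
  rewrite big1 // => k _; rewrite -/(coef2 _ i j) coef2M /ps_mul.
  rewrite big1 // => a _; rewrite big1 // => b _; rewrite [X in _ * X]coef2_exp_low ?mulr0 //.
  by rewrite addSn ltnS (leq_trans _ (leq_addr _ _)) // leq_add // leq_subr.
exists u; apply/funext => i; apply/funext => j.
rewrite (@ps_mul_agree _ _ (coef2 p) (coef2 (c * \sum_(k < (i + j).+1) w ^+ k))) //; last first.
  by move=> a b ai bj; apply: uE; rewrite ltnS leq_add.
rewrite -coef2M mulrA [p * c]mulrC.
have -> : c * p = 1 - w by rewrite wE opprB addrC subrK.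
rewrite -[1 - w]opprB mulNr -subrX1 opprB B1 (coef2_exp_low w0 (ltnSn _)).
exact: subr0.
Qed.

Lemma ps_cancel p f g : coef2 p 0 0 != 0 ->
  ps_mul (coef2 p) f = ps_mul (coef2 p) g -> f = g.
Proof.
move=> /ps_inv[u pu] e; rewrite -[f]ps_mul1 -[g]ps_mul1 -pu.
by rewrite [ps_mul _ u]ps_mulC -!ps_mulA e.
Qed.

End PowerSeries.

(** * Power series in [z2]: division by polynomials within square-summable sequences *)

Section Sequences.
Context {R : realType}.
Local Notation C := R[i].
Implicit Types (a b : {poly C}) (f g : ps1 R) (z : C).

Definition pconv a f : ps1 R := fun k => \sum_(j < k.+1) a`_j * f (k - j)%N.

Lemma pconvE K a f k : (k < K)%N -> pconv a f k = (a * \poly_(i < K) f i)`_k.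
Proof.
move=> kK; rewrite coefM; apply: eq_bigr => j _.
by rewrite coef_poly (leq_ltn_trans (leq_subr _ _) kK).
Qed.

Lemma pconvM a b f : pconv (a * b) f = pconv a (pconv b f).
Proof.
apply/funext => k; rewrite (pconvE _ _ (ltnSn k)) -mulrA coefM.
apply: eq_bigr => j _; congr (_ * _); rewrite (@pconvE k.+1) // ltnS.
exact: leq_subr.
Qed.

Lemma pconvD a f g (c : C) :
  pconv a (fun k => c * f k + g k) = (fun k => c * pconv a f k + pconv a g k).
Proof.
apply/funext => k; rewrite /pconv mulr_sumr -big_split /=.
by apply: eq_bigr => j _; rewrite mulrDr mulrCA.
Qed.

Lemma pconvC (c : C) f : pconv c%:P f = (fun k => c * f k).
Proof.
apply/funext => k; rewrite /pconv big_ord_recl coefC /= subn0 big1 ?addr0 // => j _.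
by rewrite coefC /= mul0r.
Qed.

Lemma pconvMX a c f : pconv (a * 'X + c%:P) f =
  (fun k => (if k is k'.+1 then pconv a f k' else 0) + c * f k).
Proof.
apply/funext => k; rewrite /pconv big_ord_recl coefD coefMX coefC /= add0r subn0.
rewrite addrC; congr (_ + _); case: k => [|k]; first by rewrite big_ord0.
by apply: eq_bigr => j _; rewrite coefD coefMX coefC /= addr0.
Qed.

Lemma pconv_XsubC z f : pconv ('X - z%:P) f =
  (fun k => (if k is k'.+1 then f k' else 0) - z * f k).
Proof.
rewrite -polyCN -[X in X + _]mul1r pconvMX; apply/funext => k.
by rewrite mulNr; congr (_ - _); case: k => // k; rewrite -[1]/(1%:P) pconvC mul1r.
Qed.

Lemma pconv0 f : pconv 0 f = (fun=> 0).
Proof. by apply/funext => k; rewrite /pconv big1 // => j _; rewrite coef0 mul0r. Qed.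

Definition l2 f := exists M : R, forall N, \sum_(k < N) sqmod (f k) <= M.

Lemma l2P f : inH2_1 f <-> l2 f.
Proof.
have E N : real_complex R (\sum_(k < N) sqmod (f k)) = \sum_(k < N) `|f k| ^+ 2.
  by rewrite rmorph_sum /=; apply: eq_bigr => i _; rewrite sqmodE.
split=> [[[M M'] h]|[M h]].
- by exists M => N; have := h N; rewrite -E lecE /= => /andP[].
- by exists (real_complex R M) => N; rewrite -E lecR.
Qed.

Lemma l2_lin (c : C) f g : l2 f -> l2 g -> l2 (fun k => c * f k + g k).
Proof.
move=> [M hM] [M' hM']; exists (2 * sqmod c * M + 2 * M') => N.
apply: (@le_trans _ _ (2 * sqmod c * \sum_(k < N) sqmod (f k)
                       + 2 * \sum_(k < N) sqmod (g k))).
  rewrite !mulr_sumr -big_split /=; apply: ler_sum => k _.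
  by apply: le_trans (sqmodD_le _ _) _; rewrite sqmodM mulrA.
by apply: lerD; apply: ler_wpM2l => //; rewrite mulr_ge0 ?sqmod_ge0.
Qed.

Lemma l2_0 : l2 (fun=> 0).
Proof. by exists 0 => N; rewrite big1 // => k _; rewrite sqmod0. Qed.

Lemma l2_scale (c : C) f : l2 f -> l2 (fun k => c * f k).
Proof.
move=> hf; have := l2_lin c hf l2_0; congr l2; apply/funext => k.
by rewrite addr0.
Qed.

Lemma l2_shift f : l2 f -> l2 (fun k => if k is k'.+1 then f k' else 0).
Proof.
move=> [M hM]; exists M => -[|N]; first by have := hM 0%N; rewrite !big_ord0.
by rewrite big_ord_recl /= sqmod0 add0r; exact: hM.
Qed.

Lemma l2_pconv a f : l2 f -> l2 (pconv a f).
Proof.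
move=> hf; elim/poly_ind: a => [|a c IH]; first by rewrite pconv0; exact: l2_0.
rewrite pconvMX; have := l2_lin c hf (l2_shift IH); congr l2.
by apply/funext => k; rewrite addrC.
Qed.

Lemma l2_sum I (r : seq I) (F : I -> ps1 R) : (forall i, l2 (F i)) ->
  l2 (fun k => \sum_(i <- r) F i k).
Proof.
move=> hF; elim: r => [|i r IH].
  by under eq_fun do rewrite big_nil; exact: l2_0.
under eq_fun do rewrite big_cons; have := l2_lin 1 (hF i) IH; congr l2.
by apply/funext => k; rewrite mul1r.
Qed.

Lemma l2_finite f n : (forall k, (n <= k)%N -> f k = 0) -> l2 f.
Proof.
move=> hf; exists (\sum_(k < n) sqmod (f k)) => N.
have [Nn|nN] := leqP N n.
  by apply: (@leq_sum_ord _ (fun k => sqmod (f k))) => // k; exact: sqmod_ge0.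
rewrite -(subnKC (ltnW nN)) big_split_ord /= [X in _ + X]big1 ?addr0 // => k _.
by rewrite hf ?sqmod0 // leq_addr.
Qed.

Lemma l2_cvg0 f : l2 f -> cvgC f 0.
Proof.
move=> [M hM]; apply: cvgC_sqmod.
have : series (fun k => sqmod (f k - 0)) n @[n --> \oo] -->
    limn (series (fun k => sqmod (f k - 0))).
  apply: nondecreasing_is_cvgn.
    apply: nondecreasing_series => k _ _; exact: sqmod_ge0.
  exists M => _ [N _ <-]; rewrite /series /= big_mkord.
  by under eq_bigr do rewrite subr0.
by move=> /cvgP /cvg_series_cvg_0.
Qed.

(** With [h] the product, [z f_k = f_(k-1) - h_k]. A weighted triangle inequality for [|z f_k|^2],
    summed over [k], lets the sum of the [|f_(k-1)|^2] be absorbed on the left because [|z| > 1]. *)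
Lemma l2_divX z f : 1 < sqmod z -> l2 (pconv ('X - z%:P) f) -> l2 f.
Proof.
set s := sqmod z => s1 [M hM].
(* Half of the gap between [1] and [s], so that [1 + d < s] and [s - 1 - d] can be divided by. *)
pose d := (s - 1) / 2; have d0 : 0 < d by rewrite divr_gt0 // subr_gt0.
have key (x y : C) : sqmod (x + y) <= (1 + d) * sqmod x + (1 + d^-1) * sqmod y.
  have dd : d * d^-1 = 1 by rewrite divff // lt0r_neq0.
  (* [ring] sees [d] and [d^-1] as independent; the last summand corrects for this and vanishes
     since [d * d^-1 = 1]. *)
  have -> : (1 + d) * sqmod x + (1 + d^-1) * sqmod y
      = sqmod (x + y) + d * sqmod (x - real_complex R d^-1 * y)
        + (1 - d * d^-1) * (d^-1 * sqmod y - 2 * (complex.Re x * complex.Re y + complex.Im x * complex.Im y)).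
    rewrite /sqmod !Re_add !Im_add !Re_opp !Im_opp !Re_mul !Im_mul /=; ring.
  by rewrite dd subrr mul0r addr0 lerDl mulr_ge0 ?sqmod_ge0 // ltW.
exists ((1 + d^-1) * M / (s - 1 - d)) => N.
have sd : 0 < s - 1 - d by rewrite /d; lra.
rewrite ler_pdivlMr //.
have h : s * \sum_(k < N) sqmod (f k) <=
    (1 + d) * \sum_(k < N) sqmod (f k) + (1 + d^-1) * M.
  apply: (@le_trans _ _ ((1 + d) * \sum_(k < N) sqmod (if (k : nat) is k'.+1 then f k' else 0)
     + (1 + d^-1) * \sum_(k < N) sqmod (pconv ('X - z%:P) f k))).
    rewrite !mulr_sumr -big_split /=; apply: ler_sum => k _.
    rewrite -sqmodM pconv_XsubC -[sqmod (_ - _)]sqmodN.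
    by apply: le_trans (key _ _); rewrite opprB addrC subrK.
  apply: lerD; apply: ler_wpM2l => //; try by rewrite addr_ge0 // ?invr_ge0 ltW.
  case: (N) => [|n]; first by rewrite !big_ord0.
  rewrite big_ord_recl /= sqmod0 add0r [leRHS]big_ord_recr /= lerDl.
  exact: sqmod_ge0.
by rewrite mulrC; lra.
Qed.

Lemma poly_root_ex b : (1 < size b)%N -> exists z, root b z.
Proof. by move=> sb; apply/closed_rootP; rewrite gtn_eqF. Qed.

(** Over [R[i]] such a [b] is a constant times factors ['X - z] with [|z| > 1], which [l2_divX]
    undoes one at a time. *)
Lemma l2_div b f : (forall z, sqmod z <= 1 -> b.[z] != 0) ->
  l2 (pconv b f) -> l2 f.
Proof.
elim: {b}_.+1 {-2}b (ltnSn (size b)) => // n IH b sb hb hf.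
have [sb1|sb1] := leqP (size b) 1.
  move: hf (hb 0); rewrite sqmod0 => /[swap] /(_ ler01).
  rewrite (size1_polyC sb1) hornerC pconvC => c0 hf.
  have := l2_scale (b`_0)^-1 hf; congr l2; apply/funext => k.
  by rewrite mulrA mulVf ?mul1r.
have [z rz] := poly_root_ex sb1.
have z1 : 1 < sqmod z.
  by rewrite ltNge; apply: contraL rz => /hb; rewrite rootE.
move/factor_theorem: rz => [c bE]; apply: (IH c).
- have : b != 0 by rewrite -size_poly_gt0 ltnW.
  rewrite bE mulf_eq0 negb_or => /andP[c0 _].
  by move: sb; rewrite bE size_Mmonic ?monicXsubC // size_XsubC addn2.
- by move=> x /hb; rewrite bE hornerM mulf_eq0 negb_or => /andP[].
- by apply: (l2_divX z1); rewrite -pconvM mulrC -bE.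
Qed.

(** A zero [z] of [b] with [|z| <= 1] cancels. Write [b = c ('X - z)] and [G = c g]: past the degree
    of [a], [G_k = z G_(k+1)], so [|G_k|] is nondecreasing, yet it tends to [0]. Hence [c g] is a
    polynomial and [c] can replace [b]. *)
Lemma l2_rational b g (a : {poly C}) : l2 g -> b != 0 ->
  pconv b g = (fun k => a`_k) ->
  exists a' b' : {poly C}, (forall z, sqmod z <= 1 -> b'.[z] != 0) /\
    pconv b' g = (fun k => a'`_k).
Proof.
move=> hg; elim: {b}_.+1 {-2}b (ltnSn (size b)) a => // n IH b sb a b0 e.
have [[z [z1 rz]]|nz] := pselect (exists z, sqmod z <= 1 /\ root b z); last first.
  exists a, b; split=> // z z1; apply/negP => /eqP bz; apply: nz.
  by exists z; split=> //; apply/eqP.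
move/factor_theorem: rz => [c bE].
have c0 : c != 0 by move: b0; rewrite bE mulf_eq0 negb_or => /andP[].
have hG := l2_pconv c hg; set G := pconv c g in hG.
have eG k : (if k is k'.+1 then G k' else 0) - z * G k = a`_k.
  by rewrite -[LHS](congr1 (fun u => u k) (pconv_XsubC z G)) -pconvM mulrC -bE e.
have step k : (size a <= k)%N -> sqmod (G k) <= sqmod (G k.+1).
  move=> ka; have := eG k.+1; rewrite nth_default ?(leq_trans ka) //= => /eqP.
  rewrite subr_eq0 => /eqP ->; rewrite sqmodM ler_piMl ?sqmod_ge0 //.
have mono k t : (size a <= k)%N -> sqmod (G k) <= sqmod (G (t + k)%N).
  move=> ka; elim: t => // t /le_trans; apply; apply: step.
  by rewrite (leq_trans ka) // leq_addl.
have Gz k : (size a <= k)%N -> G k = 0.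
  move=> ka; apply: sqmod_eq0; apply/eqP; rewrite eq_le sqmod_ge0 andbT.
  have h0 := cvg_sqmod (l2_cvg0 hG); rewrite sqmod0 in h0.
  rewrite -(cvg_lim (@Rhausdorff R) h0); apply: limr_ge.
    by apply: cvgP h0.
  by exists k => // l /= kl; rewrite -(subnK kl); exact: mono.
have [] := IH c _ (\poly_(k < size a) G k) c0.
- by move: sb; rewrite bE size_Mmonic ?monicXsubC // size_XsubC addn2.
- apply/funext => k; rewrite coef_poly; case: ltnP => // ka.
  exact: Gz.
by move=> a' [b' h]; exists a', b'.
Qed.

End Sequences.


(** * Multiplication by a rational inner function *)

Section SchurCohn.
Context {R : realType}.
Local Notation C := R[i].
Implicit Types (a b f : {poly C}) (z : C) (m n K : nat).

(** The reflection is taken at a nominal degree [m], not at the degree of [a], because a slice of a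
    polynomial in two variables may lose degree. *)
Definition refl1 m a : {poly C} := \poly_(k < m.+1) Num.conj (a`_(m - k)%N).
Definition csum K f : R := \sum_(k < K) sqmod f`_k.

Lemma csum_MX K f : csum K ('X * f) <= csum K f.
Proof.
case: K => [|K]; first by rewrite /csum !big_ord0.
rewrite /csum big_ord_recl coefXM /= sqmod0 add0r [leRHS]big_ord_recr /=.
rewrite -[leLHS]addr0; apply: lerD; last exact: sqmod_ge0.
by apply: ler_sum => k _; rewrite coefXM.
Qed.

(* The two partial sums differ by [(|z|^2 - 1) |f_(K-1)|^2]. *)
Lemma csum_blaschke K f z : 1 <= sqmod z ->
  csum K ((1 - Num.conj z *: 'X) * f) <= csum K (('X - z%:P) * f).
Proof.
move=> z1; have -> : csum K (('X - z%:P) * f) = csum K ((1 - Num.conj z *: 'X) * f)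
    + (sqmod z - 1) * (if K is k.+1 then sqmod f`_k else 0).
  elim: K => [|K IH]; first by rewrite /csum !big_ord0 mulr0 addr0.
  rewrite /csum !big_ord_recr /= -/(csum K _) -/(csum K _) IH.
  have -> : ((1 - Num.conj z *: 'X) * f)`_K = f`_K - Num.conj z * ('X * f)`_K.
    by rewrite mulrBl mul1r -scalerAl coefB coefZ.
  have -> : (('X - z%:P) * f)`_K = ('X * f)`_K - z * f`_K.
    by rewrite mulrBl coefB coefCM.
  rewrite coefXM; move: (csum K _) => X.
  case: K {IH} => [|K] /=; rewrite /sqmod !Re_add !Im_add !Re_opp !Im_opp
    !Re_mul !Im_mul !Re_cj !Im_cj /=; ring.
rewrite lerDl mulr_ge0 ?subr_ge0 //; case: (K) => // k; exact: sqmod_ge0.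
Qed.

(** Roots of [a] are split off one at a time. Each has [|z| >= 1], and its factor reflects to
    [1 - conj z X], which [csum_blaschke] compares with [X - z]. If the degree of [a] is below [m],
    the reflection gains a factor [X], which only pushes coefficients out of the first [K]. *)
Lemma schur_cohn m a : (size a <= m.+1)%N ->
  (forall z, sqmod z < 1 -> a.[z] != 0) ->
  forall K f, csum K (refl1 m a * f) <= csum K (a * f).
Proof.
elim: m a => [|m IH] a sa ha K f.
  have -> : refl1 0 a = (Num.conj a`_0)%:P.
    by apply/polyP => k; rewrite coef_poly coefC; case: k => [|k].
  rewrite (size1_polyC sa) coefC /=; apply: ler_sum => k _.
  by rewrite !coefCM !sqmodM sqmodJ.
have [sa'|sa'] := leqP (size a) m.+1.
  have -> : refl1 m.+1 a = 'X * refl1 m a.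
    apply/polyP => k; rewrite coefXM !coef_poly; case: k => [|k] /=.
      by rewrite subn0 nth_default // rmorph0.
    by rewrite ltnS subSS.
  by rewrite -mulrA; apply: le_trans (csum_MX _ _) _; exact: IH.
have sE : size a = m.+2 by apply/eqP; rewrite eqn_leq sa.
have [z rz] : exists z, root a z by apply: poly_root_ex; rewrite sE.
have z1 : 1 <= sqmod z.
  by rewrite leNgt; apply: contraL rz => /ha; rewrite rootE.
move/factor_theorem: rz => [b aE].
have b0 : b != 0.
  by apply: contra_eqN sE => /eqP b0; rewrite aE b0 mul0r size_poly0.
have sb : size b = m.+1.
  by move: sE; rewrite aE size_Mmonic ?monicXsubC // size_XsubC addn2 => -[].
have -> : refl1 m.+1 a = (1 - Num.conj z *: 'X) * refl1 m b.
  apply/polyP => k; rewrite mulrBl mul1r -scalerAl coefB coefZ coefXM !coef_poly.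
  have ac l : Num.conj a`_l = Num.conj (if l is l'.+1 then b`_l' else 0) - Num.conj z * Num.conj b`_l.
    by rewrite aE mulrBr coefB coefMX coefMC rmorphB rmorphM mulrC; case: l.
  rewrite ac; case: k => [|k] /=.
    by rewrite !subn0 [b`_m.+1]nth_default ?sb // rmorph0 !mulr0.
  rewrite !ltnS subSS; case: (ltngtP k m) => km.
  - by rewrite -{1}(subnSK km).
  - by rewrite mulr0 subrr.
  - by rewrite km subnn rmorph0.
rewrite -mulrA; apply: le_trans (csum_blaschke _ _ z1) _.
(* The factor ['X - z] is moved onto [f], which the induction hypothesis leaves arbitrary. *)
rewrite mulrCA aE -mulrA; apply: IH; first by rewrite sb.
by move=> x /ha; rewrite aE hornerM mulf_eq0 negb_or => /andP[].
Qed.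

Lemma prim_root_ex n : (0 < n)%N -> exists w : C, n.-primitive_root w.
Proof.
move=> n_gt0; pose p : {poly C} := 'X^n - 1; have [r Dp] := closed_field_poly_normal p.
move: Dp; rewrite lead_coefDl ?size_polyXn ?size_polyN ?size_poly1 ?ltnS //.
rewrite lead_coefXn scale1r => Dp.
have rn1 : all n.-unity_root r.
  apply/allP => z; rewrite -root_prod_XsubC -Dp rootE hornerD hornerN hornerC.
  by rewrite hornerXn subr_eq0 unity_rootE.
have sz_r : (n < (size r).+1)%N by rewrite -(size_prod_XsubC r id) -Dp size_XnsubC.
have ur : uniq r.
  rewrite -separable_prod_XsubC -Dp separable_Xn_sub_1 //.
  by rewrite pnatr_eq0 -lt0n.
by have /hasP[w _ hw] := has_prim_root n_gt0 rn1 ur sz_r; exists w.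
Qed.

Lemma prim_root_sqmod n (w : C) : n.-primitive_root w -> sqmod w = 1.
Proof.
move=> pw; have n0 := prim_order_gt0 pw.
have /eqP := sqmodX w n; rewrite (prim_expr_order pw) sqmod1 eq_sym.
by rewrite pexpr_eq1 ?sqmod_ge0 // => /eqP.
Qed.

Lemma sum_roots_of_unity n (w : C) (x : C) : n.-primitive_root w -> x ^+ n = 1 ->
  \sum_(s < n) x ^+ s = if x == 1 then n%:R else 0.
Proof.
move=> pw xn; have [->|x1] := eqVneq x 1.
  by under eq_bigr do rewrite expr1n; rewrite sumr_const card_ord.
have : (x - 1) * \sum_(s < n) x ^+ s = 0 by rewrite -subrX1 xn subrr.
by move/eqP; rewrite mulf_eq0 subr_eq0 (negbTE x1) => /eqP.
Qed.

(** Averaging over roots of unity stands in for integration over the circle. The bound on [size h]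
    excludes aliasing: exponents below [n] that agree modulo [n] are equal. *)
Lemma parseval_discrete n (w : C) (h : {poly C}) : n.-primitive_root w ->
  (size h <= n)%N ->
  \sum_(s < n) sqmod h.[w ^+ s] = n%:R * csum n h.
Proof.
move=> pw sh; have ww : w * Num.conj w = 1.
  by rewrite sqmod_mulJ (prim_root_sqmod pw).
have w0 : w != 0 by apply: contra_eq_neq ww => ->; rewrite mul0r eq_sym oner_neq0.
have wJ : Num.conj w = w^-1 by apply: (mulfI w0); rewrite ww divff.
apply: (@complexI R); rewrite rmorph_sum rmorphM rmorph_nat /csum rmorph_sum /=.
have key (s j k : nat) : (h`_j * (w ^+ s) ^+ j) * Num.conj (h`_k * (w ^+ s) ^+ k)
    = h`_j * Num.conj h`_k * (w ^+ j * w^-1 ^+ k) ^+ s.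
  rewrite conjM !rmorphXn /= wJ exprMn -!exprM !(mulnC s).
  by rewrite mulrACA.
under eq_bigr => s _.
  rewrite -sqmod_mulJ (horner_coef_wide _ sh) conj_sum big_distrlr /=.
  under eq_bigr => j _ do under eq_bigr => k _ do rewrite key.
  over.
rewrite exchange_big /= mulr_sumr; apply: eq_bigr => j _.
rewrite exchange_big /= (bigD1 j) //= [X in _ + X]big1 ?addr0.
  rewrite -mulr_sumr (sum_roots_of_unity pw); last first.
    by rewrite exprMn -!exprM ![(_ * n)%N]mulnC !exprM exprVn (prim_expr_order pw) invr1 !expr1n mulr1.
  by rewrite exprVn divff ?expf_neq0 // eqxx mulrC sqmod_mulJ.
move=> k kj; rewrite -mulr_sumr (sum_roots_of_unity pw); last first.
  by rewrite exprMn -!exprM ![(_ * n)%N]mulnC !exprM exprVn (prim_expr_order pw) invr1 !expr1n mulr1.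
rewrite ifF ?mulr0 //; apply/negbTE; apply: contra kj => /eqP e.
have : w ^+ j = w ^+ k by rewrite -[RHS]mul1r -e -mulrA -exprMn mulVf // expr1n mulr1.
move/eqP; rewrite (eq_prim_root_expr pw) !modn_small ?ltn_ord // => /eqP h1.
by apply/eqP/val_inj.
Qed.

End SchurCohn.

(** * From slices to the bidisk: multiplication by [Theta] is bounded *)

Section BidiskInner.
Context {R : realType}.
Local Notation C := R[i].
Implicit Types (p q : poly2 R) (f g : ps2 R) (z w : C) (m n K L : nat).

Definition rows_le n p := forall i, (size (pcoef p i) <= n)%N.

Lemma rows_leM n L p q : rows_le n.+1 p -> rows_le L q -> rows_le (n + L) (p * q).
Proof.
move=> hp hq i; rewrite /pcoef coefM; apply: (leq_trans (size_sum _ _ _)).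
apply/bigmax_leqP => a _; apply: (leq_trans (size_polyMleq _ _)).
have := hp a; have := hq (i - a)%N; rewrite /pcoef.
by move: (size p`_a) (size _) => x y; lia.
Qed.

Lemma rows_le_refl2 m n p : rows_le n.+1 (refl2 m n p).
Proof.
move=> i; rewrite /pcoef coef_poly; case: ifP => _; last by rewrite size_poly0.
exact: size_poly.
Qed.

Lemma coef2_refl2 m n p a b : coef2 (refl2 m n p) a b =
  if ((a < m.+1) && (b < n.+1))%N then Num.conj (coef2 p (m - a)%N (n - b)%N) else 0.
Proof.
rewrite /coef2 coef_poly; case: ltnP => _ /=; last by rewrite coef0.
by rewrite coef_poly.
Qed.

(** Since [conj w = w^-1] on the circle, reflecting the [z2]-coefficients amounts to conjugating
    their values, up to the unimodular factor [w ^+ n]. *)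
Lemma refl2_slice m n p w : rows_le n.+1 p -> sqmod w = 1 ->
  map_poly (horner_eval w) (refl2 m n p) =
  w ^+ n *: refl1 m (map_poly (horner_eval w) p).
Proof.
move=> rp w1; have ww : w * Num.conj w = 1 by rewrite sqmod_mulJ w1.
apply/polyP => i; rewrite coefZ coef_map /=.
rewrite [(refl2 _ _ _)`_i]coef_poly [(refl1 _ _)`_i]coef_poly.
case: ltnP => _; last by rewrite /horner_eval horner0 mulr0.
rewrite coef_map /= /horner_eval horner_poly (horner_coef_wide _ (rp _)).
rewrite conj_sum mulr_sumr (reindex_inj rev_ord_inj) /=.
apply: eq_bigr => -[j /=]; rewrite ltnS => jn _.
rewrite subSS subKn // conjM rmorphXn /= mulrCA; congr (_ * _).
by rewrite -{2}(subnK jn) exprD -mulrA -exprMn ww expr1n mulr1.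
Qed.

Lemma csumZ K (c : C) (h : {poly C}) : csum K (c *: h) = sqmod c * csum K h.
Proof. by rewrite /csum mulr_sumr; apply: eq_bigr => i _; rewrite coefZ sqmodM. Qed.

(** Only the [z1]-degree is cut, at [K]: discrete Parseval needs all [z2]-coefficients of both
    products below [L], so [f] has to be a polynomial. Being zero-free on [|w| = 1] is supplied
    later by the dilation. *)
Lemma slice_inequality m n p (f : poly2 R) K L : (size p <= m.+1)%N ->
  rows_le n.+1 p ->
  (forall z w, sqmod z < 1 -> sqmod w = 1 -> eval2 p z w != 0) ->
  (0 < L)%N -> rows_le L (refl2 m n p * f) -> rows_le L (p * f) ->
  \sum_(i < K) csum L (pcoef (refl2 m n p * f) i) <= \sum_(i < K) csum L (pcoef (p * f) i).
Proof.
move=> sp rp hp L0 r1 r2; have [w pw] := @prim_root_ex R L L0.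
have w1 s : sqmod (w ^+ s) = 1 by rewrite sqmodX (prim_root_sqmod pw) expr1n.
have avg (h : poly2 R) : rows_le L h -> L%:R * \sum_(i < K) csum L (pcoef h i) =
    \sum_(s < L) csum K (map_poly (horner_eval (w ^+ s)) h).
  move=> rh; rewrite [RHS]exchange_big mulr_sumr /=; apply: eq_bigr => i _.
  rewrite -(parseval_discrete pw (rh i)).
  by apply: eq_bigr => s _; rewrite coef_map.
rewrite -(@ler_pM2l _ L%:R) ?ltr0n // !avg //; apply: ler_sum => s _.
rewrite !rmorphM /= (refl2_slice _ rp (w1 s)) -scalerAl csumZ sqmodX w1 expr1n mul1r.
apply: schur_cohn; first by apply: leq_trans (size_poly _ _) sp.
by move=> z z1; exact: hp.
Qed.

Definition dil (r : R) f : ps2 R := fun i j => f i j * real_complex R (r ^+ j).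

Definition pdil (r : R) p : poly2 R := \poly_(i < size p)
  \poly_(j < size (pcoef p i)) (coef2 p i j * real_complex R (r ^+ j)).

Lemma coef2_pdil r p : coef2 (pdil r p) = dil r (coef2 p).
Proof.
apply/funext => i; apply/funext => j; rewrite /dil {1}/coef2 coef_poly.
case: ltnP => hi; last by rewrite /coef2 [p`_i]nth_default // !coef0 mul0r.
rewrite coef_poly; case: ltnP => hj //.
by rewrite /coef2 [(p`_i)`_j]nth_default // mul0r.
Qed.

Lemma dil_mul r f g : ps_mul (dil r f) (dil r g) = dil r (ps_mul f g).
Proof.
apply/funext => i; apply/funext => j; rewrite /dil /ps_mul mulr_suml.
apply: eq_bigr => a _; rewrite mulr_suml; apply: eq_bigr => -[b /=].
rewrite ltnS => bj _; rewrite mulrACA -rmorphM /= -exprD.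
by rewrite subnKC.
Qed.

Lemma rows_le_pdil r n p : rows_le n p -> rows_le n (pdil r p).
Proof.
move=> rp i; rewrite /pcoef coef_poly; case: ifP => _; last by rewrite size_poly0.
by apply: leq_trans (size_poly _ _) (rp i).
Qed.

Lemma eval2E p z w : eval2 p z w = (map_poly (horner_eval w) p).[z].
Proof. by []. Qed.

Lemma eval2_pdil r p z w : eval2 (pdil r p) z w = eval2 p z (real_complex R r * w).
Proof.
rewrite !eval2E; congr (_.[z]); apply/polyP => i.
rewrite !coef_map /= /horner_eval coef_poly.
case: ltnP => hi; last by rewrite [p`_i]nth_default // !horner0.
rewrite horner_poly horner_coef; apply: eq_bigr => j _.
by rewrite exprMn rmorphXn /= mulrA.
Qed.

Lemma ps_mul_row p f i : ps_mul (coef2 p) f i =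
  (fun j => \sum_(a < i.+1) pconv (pcoef p a) (f (i - a)%N) j).
Proof. by []. Qed.

(** Coefficients of [z1 ^ i] give [p_0 f_i = g_i - sum_(a >= 1) p_a f_(i-a)]; division by [p_0(z2)],
    zero-free on the closed disk, keeps square summability, and the rows follow by strong
    induction. *)
Lemma quotient_rows_l2 p f g : (forall w, sqmod w <= 1 -> (pcoef p 0).[w] != 0) ->
  ps_mul (coef2 p) f = g -> (forall i, l2 (g i)) -> forall i, l2 (f i).
Proof.
move=> hp e hg i; elim/ltn_ind: i => i IH; apply: (l2_div hp).
have := l2_lin (-1) (@l2_sum _ _ (index_enum _) _ (fun a : 'I_i =>
   l2_pconv (pcoef p (lift ord0 a)) (IH (i - lift ord0 a)%N _))) (hg i).
have h (a : 'I_i) : (i - lift ord0 a < i)%N.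
  by rewrite /= /bump /= add1n; case: a => a /= ai; lia.
move=> /(_ h); congr l2; apply/funext => j.
by rewrite -e ps_mul_row big_ord_recl /= subn0 mulN1r addrC addrK.
Qed.

(* Truncating [f] to [z2]-degree [< L] creates only [n] extra columns in [p * f],
   and they tend to [0] with [L] because the dilation makes the rows of [f] square-summable. *)
Lemma inner_bound_dilated m n p f (G : poly2 R) K D r : 0 < r < 1 ->
  (size p <= m.+1)%N -> rows_le n.+1 p ->
  (forall z w, sqmod z < 1 -> sqmod w < 1 -> eval2 p z w != 0) ->
  ps_mul (coef2 p) f = coef2 G ->
  (forall i j, ~~ ((i < D) && (j < D))%N -> coef2 G i j = 0) ->
  psum K (ps_mul (coef2 (refl2 m n (pdil r p))) (dil r f)) <= psum D (coef2 G).
Proof.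
move=> /andP[r0 r1] sp rp hp e hG; set P := pdil r p; set F := dil r f.
have rP : rows_le n.+1 P by exact: rows_le_pdil.
have sP : (size P <= m.+1)%N by apply: leq_trans (size_poly _ _) sp.
have hP z w : sqmod z < 1 -> sqmod w <= 1 -> eval2 P z w != 0.
  move=> z1 w1; rewrite eval2_pdil hp // sqmodM sqmod_real.
  by rewrite (le_lt_trans (ler_piMr _ w1)) ?sqr_ge0 // expr_lt1 // ltW.
have hP1 z w : sqmod z < 1 -> sqmod w = 1 -> eval2 P z w != 0.
  by move=> z1 w1; apply: hP => //; rewrite w1.
have P0 w : sqmod w <= 1 -> (pcoef P 0).[w] != 0.
  move=> w1; have := hP 0 w; rewrite sqmod0 ltr01 => /(_ isT w1).
  by rewrite eval2E horner_coef0 coef_map.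
have eP : ps_mul (coef2 P) F = dil r (coef2 G) by rewrite coef2_pdil dil_mul e.
have Fl2 : forall i, l2 (F i).
  apply: (quotient_rows_l2 P0 eP) => i; apply: (@l2_finite _ _ D) => j Dj.
  by rewrite /dil hG ?mul0r // negb_and -!leqNgt Dj orbT.
pose FL L : poly2 R := \poly_(i < K) \poly_(j < L) F i j.
have FLE L i j : (i < K)%N -> coef2 (FL L) i j = if (j < L)%N then F i j else 0.
  by move=> iK; rewrite /coef2 coef_poly iK coef_poly.
have rFL L : rows_le L (FL L).
  move=> i; rewrite /pcoef coef_poly; case: ifP => _; last by rewrite size_poly0.
  exact: size_poly.
have agree (q : poly2 R) L i j : (i < K)%N -> (j < L)%N ->
    coef2 (q * FL L) i j = ps_mul (coef2 q) F i j.
  move=> iK jL; rewrite coef2M; apply: ps_mul_agree => // a b ai bj.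
  by rewrite FLE ?(leq_ltn_trans ai) // (leq_ltn_trans bj jL).
pose err L : R := \sum_(i < K) \sum_(t < n) sqmod (coef2 (P * FL L) i (L + t)%N).
(* [L > K + D] puts the [K]-block and the support of [G] below the cut at [L]; the [n] columns from
   [L] on make up [err L]. *)
have main L : (K + D < L)%N -> psum K (ps_mul (coef2 (refl2 m n P)) F)
    <= psum D (coef2 G) + err L.
  move=> KL; have L0 : (0 < L)%N by apply: leq_ltn_trans KL.
  have := @slice_inequality m n P (FL L) K (n + L) sP rP
    hP1.
  rewrite addn_gt0 L0 orbT => /(_ isT).
  move=> /(_ (rows_leM (@rows_le_refl2 _ _ _) (rFL L)) (rows_leM rP (rFL L))) H.
  apply: le_trans (le_trans _ H) _.
    rewrite /psum /csum; apply: ler_sum => i _.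
    apply: le_trans (_ : \sum_(j < K) sqmod (coef2 (refl2 m n P * FL L) i j) <= _); last first.
      apply: (@leq_sum_ord _ (fun j => sqmod (coef2 (refl2 m n P * FL L) i j))); first lia.
      by move=> j; exact: sqmod_ge0.
    apply: ler_sum => j _; rewrite agree //.
    by have := ltn_ord j; lia.
  rewrite /err -(addnC L) /csum.
  under eq_bigr do rewrite big_split_ord /=.
  rewrite big_split /=; apply: lerD => //.
  apply: (@le_trans _ _ (\sum_(i < K) \sum_(j < L) sqmod (coef2 G i j))).
    apply: ler_sum => i _; apply: ler_sum => j _.
    rewrite -/(coef2 _ i j) agree // eP /dil sqmodM sqmod_real.
    by rewrite ler_piMr ?sqmod_ge0 // exprn_ile1 ?exprn_ge0 ?exprn_ile1 ?ltW.
  apply: (@le_trans _ _ (psum L (coef2 G))).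
    apply: (@leq_sum_ord _ (fun i => \sum_(j < L) sqmod (coef2 G i j))); first lia.
    by move=> i; apply: sumr_ge0 => j _; exact: sqmod_ge0.
  have DL : (D <= L)%N by lia.
  rewrite /psum -(subnKC DL) big_split_ord /= [X in _ + X]big1 ?addr0; last first.
    move=> i _; apply: big1 => j _; rewrite hG ?sqmod0 //.
    by rewrite negb_and -leqNgt leq_addr.
  apply: ler_sum => i _; rewrite big_split_ord /= [X in _ + X]big1 ?addr0 // => j _.
  by rewrite hG ?sqmod0 // negb_and -!leqNgt leq_addr orbT.
have err0 : err L @[L --> \oo] --> (0 : R).
  have -> : (0 : R) = \sum_(i < K) \sum_(t < n) sqmod 0.
    by rewrite big1 // => i _; rewrite big1 // => t _; rewrite sqmod0.
  apply: cvgR_sum => i; apply: cvgR_sum => t; apply: cvg_sqmod.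
  (* The same coefficient with a number of terms independent of [L], so that the limit is taken
     termwise. The test [t < b] expresses that [L + t - b] lies below the cut. *)
  pose T L : C := \sum_(a < i.+1) \sum_(b < n.+1)
    coef2 P a b * (if (t < b)%N && (b <= L + t)%N then F (i - a)%N (L + t - b)%N else 0).
  have TE L : coef2 (P * FL L) i (L + t)%N = T L.
    rewrite coef2M; apply: eq_bigr => a _.
    pose U b := coef2 P a b *
      (if (t < b)%N && (b <= L + t)%N then F (i - a)%N (L + t - b)%N else 0).
    transitivity (\sum_(b < (L + t).+1) U b).
      apply: eq_bigr => -[b /=]; rewrite ltnS => bL _; rewrite /U bL andbT FLE; last first.
        exact: leq_ltn_trans (leq_subr _ _) (ltn_ord i).
      have -> // : (L + t - b < L)%N = (t < b)%N by lia.
    transitivity (\sum_(b < maxn (L + t).+1 n.+1) U b).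
      apply/esym/sum_ord_widen; first exact: leq_maxl.
      by move=> b bL; rewrite /U (leqNgt b) bL andbF mulr0.
    apply: sum_ord_widen; first exact: leq_maxr.
    move=> b bn; rewrite /U /coef2 [(P`_a)`_b]nth_default ?mul0r //.
    exact: leq_trans (rP _) bn.
  have -> : (fun L => coef2 (P * FL L) i (L + t)%N) = T by apply/funext.
  have -> : (0 : C) = \sum_(a < i.+1) \sum_(b < n.+1) coef2 P a b * 0.
    by rewrite big1 // => a _; rewrite big1 // => b _; rewrite mulr0.
  apply: cvgC_sum => a _; apply: cvgC_sum => b _; apply: cvgCM; first exact: cvgC_cst.
  apply: cvgC_sqmod; have := cvg_sqmod (l2_cvg0 (Fl2 (i - a)%N)); rewrite sqmod0.
  move=> /cvgrPdist_le h; apply/cvgrPdist_le => eps eps0.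
  have [N _ hN] := h eps eps0; exists (N + n)%N => // L /= NL.
  rewrite subr0; case: ifP => _; last by rewrite sqmod0 subrr normr0 ltW.
  by apply: hN => /=; have := ltn_ord b; lia.
have lim : psum D (coef2 G) + err L @[L --> \oo] --> psum D (coef2 G).
  by rewrite -[X in _ --> X]addr0; apply: cvgD => //; exact: cvg_cst.
rewrite -(cvg_lim (@Rhausdorff R) lim); apply: limr_ge; first by apply: cvgP lim.
by exists (K + D).+1 => // L /= h; apply: main.
Qed.

Lemma cvgC_dil (r : nat -> R) j : r k @[k --> \oo] --> (1 : R) ->
  cvgC (fun k => real_complex R (r k ^+ j)) 1.
Proof.
move=> r1; have := @cvgC_real R (fun k => r k ^+ j) 1; apply.
elim: j => [|j IH]; first by under eq_fun do rewrite expr0; exact: cvg_cst.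
have h := cvgM r1 IH; rewrite mulr1 in h.
by under eq_fun do rewrite exprS; exact: h.
Qed.

(** The bound for the dilated data is uniform in [r], and each entry is a finite expression
    continuous in [r]; so [r] may tend to [1]. *)
Lemma inner_bound m n p f (G : poly2 R) K D :
  (size p <= m.+1)%N -> rows_le n.+1 p ->
  (forall z w, sqmod z < 1 -> sqmod w < 1 -> eval2 p z w != 0) ->
  ps_mul (coef2 p) f = coef2 G ->
  (forall i j, ~~ ((i < D) && (j < D))%N -> coef2 G i j = 0) ->
  psum K (ps_mul (coef2 (refl2 m n p)) f) <= psum D (coef2 G).
Proof.
(* The factor [2^-1] keeps [r 0] positive. *)
move=> sp rp hp e hG; pose r k : R := 1 - 2^-1 * k.+1%:R^-1.
have r01 k : 0 < r k < 1.
  have h0 : 0 < (k.+1%:R : R)^-1 by rewrite invr_gt0 ltr0n.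
  have h1 : (k.+1%:R : R)^-1 <= 1 by rewrite invf_le1 ?ltr0n // ler1n.
  rewrite /r; move: (k.+1%:R^-1) h0 h1 => t h0 h1.
  by apply/andP; split; lra.
have r1 : r k @[k --> \oo] --> (1 : R).
  have h := cvgB (cvg_cst (1 : R)) (cvgM (cvg_cst (2^-1 : R)) (@cvg_harmonic R)).
  by rewrite mulr0 subr0 in h; exact: h.
apply: (@psum_fatou R (fun k => ps_mul (coef2 (refl2 m n (pdil (r k) p))) (dil (r k) f))
  _ (fun=> psum D (coef2 G))); last exact: cvg_cst.
- move=> i j; rewrite /ps_mul; apply: cvgC_sum => a _; apply: cvgC_sum => b _.
  apply: cvgCM; last first.
    by rewrite -[X in cvgC _ X]mulr1; apply: cvgCM; [exact: cvgC_cst|exact: cvgC_dil].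
  rewrite coef2_refl2; under eq_fun do rewrite coef2_refl2.
  case: ifP => _; last exact: cvgC_cst.
  under eq_fun do rewrite coef2_pdil.
  apply: cvgCJ; rewrite -[X in cvgC _ X]mulr1; apply: cvgCM; first exact: cvgC_cst.
  exact: cvgC_dil.
- by apply: nearW => k; apply: inner_bound_dilated.
Qed.

(** The [K]-block of [theta g] sees only the truncation [G] of [g], and [theta G = p~ f] with
    [p f = G]. The quotient [f] is merely formal: [inner_bound] asks no growth condition of it. *)
Lemma inH2_inner m n p theta g : (size p <= m.+1)%N -> rows_le n.+1 p ->
  (forall z w, sqmod z < 1 -> sqmod w < 1 -> eval2 p z w != 0) ->
  coef2 p 0 0 != 0 ->
  ps_mul (coef2 p) theta = coef2 (refl2 m n p) -> inH2 g ->
  inH2 (ps_mul theta g).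
Proof.
move=> sp rp hp p0 e gH; apply: (proj1 (@nsq_le _ _ (nsq g) _)) => K.
apply: le_trans (psum_le_nsq K gH); have [u pu] := ps_inv p0.
set G := ptrunc K g; pose f := ps_mul u (coef2 G).
have pf : ps_mul (coef2 p) f = coef2 G by rewrite /f ps_mulA pu ps_mul1.
have <- : psum K (coef2 G) = psum K g.
  apply: eq_bigr => i _; apply: eq_bigr => j _.
  by rewrite coef2_ptrunc !ltn_ord.
suff -> : psum K (ps_mul theta g) = psum K (ps_mul (coef2 (refl2 m n p)) f).
  apply: inner_bound => // i j; rewrite coef2_ptrunc; by case: ifP.
have <- : ps_mul theta (coef2 G) = ps_mul (coef2 (refl2 m n p)) f.
  by rewrite -pf -e ps_mulA [ps_mul theta _]ps_mulC.
apply: eq_bigr => i _; apply: eq_bigr => j _; congr (sqmod _).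
apply: ps_mul_agree => // a b ai bj.
by rewrite coef2_ptrunc (leq_ltn_trans ai) ?(leq_ltn_trans bj) ?ltn_ord.
Qed.

End BidiskInner.


(** * Fourier coefficients of rational functions *)

Section IsometricSubstitution.
Variables (K : numFieldType) (J : K -> K).
Hypothesis Jiso : forall x y, `|J x - J y| = `|x - y|.

Lemma continuous_horner_numField (p : {poly K}) : continuous (fun z : K => p.[z]).
Proof.
elim/poly_ind: p => [|p c IH].
  have -> : (fun z : K => (0 : {poly K}).[z]) = (fun=> 0).
    by apply/funext => z; rewrite horner0.
  exact: cst_continuous.
have -> : (fun z : K => (p * 'X + c%:P).[z]) =
    ((fun z : K => p.[z]) \* id) \+ (fun=> c).
  by apply/funext => z; rewrite hornerMXaddC.
move=> z; apply: continuousD; last exact: cst_continuous.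
by apply: continuousM; [exact: IH|exact: cvg_id].
Qed.

Lemma continuous_isometry : continuous J.
Proof.
move=> z; apply/(@cvgrPdist_lt _ _ _ _ (nbhs_filter z)) => e e0.
near=> y; rewrite Jiso; near: y.
by apply: (@cvgr_dist_lt _ _ _ _ (nbhs_filter z)).
Unshelve. all: by end_near. Qed.

(** Used with [J] the complex conjugation, for functions rational in [conj z]. *)
Lemma continuous_ratfun_isometry (a b : {poly K}) (z : K) : b.[J z] != 0 ->
  {for z, continuous (fun z : K => a.[J z] / b.[J z])}.
Proof.
move=> b0; have cj (p : {poly K}) : {for z, continuous (fun z : K => p.[J z])}.
  apply: (@continuous_comp K K K J (fun z => p.[z])).
    exact: continuous_isometry.
  exact: continuous_horner_numField.
by apply: continuousM; [exact: cj|apply: continuousV => //; exact: cj].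
Qed.

End IsometricSubstitution.

Section Fourier.
Context {R : realType}.
Local Notation C := R[i].
Implicit Types (F G : R -> C) (a b : {poly C}) (c : C) (k : int).

(** Coordinatewise, because [fourier] integrates real and imaginary parts separately. *)
Definition ccont F := continuous (fun t => complex.Re (F t)) /\
  continuous (fun t => complex.Im (F t)).

Definition circ_int (f : R -> R) : R :=
  \int[@lebesgue_measure R]_(t in `[0, pi *+ 2]) f t.

Definition circ_avg F : C := Complex ((pi *+ 2)^-1) 0 *
  Complex (circ_int (fun t => complex.Re (F t))) (circ_int (fun t => complex.Im (F t))).

Lemma fourierE (H : C -> C) k :
  fourier H k = circ_avg (fun t => H (expi t) * (expi t) ^ (- k)).
Proof. by []. Qed.

Lemma cont_integrable (f : R -> R) : continuous f ->
  (@lebesgue_measure R).-integrable `[0, pi *+ 2] (EFin \o f).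
Proof.
move=> cf; apply: continuous_compact_integrable; first exact: segment_compact.
exact: continuous_subspaceT.
Qed.

Lemma circ_intD (f g : R -> R) : continuous f -> continuous g ->
  circ_int (fun t => f t + g t) = circ_int f + circ_int g.
Proof. by move=> cf cg; rewrite /circ_int RintegralD //; exact: cont_integrable. Qed.

Lemma circ_intZ (r : R) (f : R -> R) : continuous f ->
  circ_int (fun t => r * f t) = r * circ_int f.
Proof. by move=> cf; rewrite /circ_int RintegralZl //; exact: cont_integrable. Qed.

Lemma contD (f g : R -> R) : continuous f -> continuous g -> continuous (fun t => f t + g t).
Proof. by move=> cf cg t; apply: cvgD; [exact: cf|exact: cg]. Qed.

Lemma contB (f g : R -> R) : continuous f -> continuous g -> continuous (fun t => f t - g t).
Proof. by move=> cf cg t; apply: cvgB; [exact: cf|exact: cg]. Qed.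

Lemma contM (f g : R -> R) : continuous f -> continuous g -> continuous (fun t => f t * g t).
Proof. by move=> cf cg t; apply: cvgM; [exact: cf|exact: cg]. Qed.

Lemma cont_cst (r : R) : continuous (fun _ : R => r).
Proof. by move=> t; exact: cvg_cst. Qed.

Lemma ccontD F G : ccont F -> ccont G -> ccont (fun t => F t + G t).
Proof.
move=> [a1 a2] [b1 b2]; split.
- by under eq_fun do rewrite Re_add; exact: contD.
- by under eq_fun do rewrite Im_add; exact: contD.
Qed.

Lemma ccontM F G : ccont F -> ccont G -> ccont (fun t => F t * G t).
Proof.
move=> [a1 a2] [b1 b2]; split.
- by under eq_fun do rewrite Re_mul; apply: contB; exact: contM.
- by under eq_fun do rewrite Im_mul; apply: contD; exact: contM.
Qed.

Lemma ccont_cst c : ccont (fun=> c).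
Proof. by split; exact: cont_cst. Qed.

Lemma cont_sqmod F : ccont F -> continuous (fun t => sqmod (F t)).
Proof.
move=> [a1 a2]; rewrite /sqmod.
by under eq_fun do rewrite !expr2; apply: contD; exact: contM.
Qed.

Lemma ccontV F : ccont F -> (forall t, F t != 0) -> ccont (fun t => (F t)^-1).
Proof.
move=> cF F0; have s0 t : sqmod (F t) != 0.
  by apply: contra_neq (F0 t) => /sqmod_eq0.
have VE t : (F t)^-1 = Num.conj (F t) * real_complex R (sqmod (F t))^-1.
  by apply: (mulfI (F0 t)); rewrite mulfV // mulrA sqmod_mulJ -rmorphM mulfV.
have cV : continuous (fun t => (sqmod (F t))^-1).
  by move=> t; apply: cvgV => //; exact: cont_sqmod.
case: (cF) => a1 a2; split.
- under eq_fun do rewrite VE Re_mul Re_cj /= mulr0 subr0; exact: contM.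
- under eq_fun do rewrite VE Im_mul Im_cj /= mulr0 add0r; apply: contM => //.
  by move=> t; apply: cvgN; exact: a2.
Qed.

Lemma ccont_sum I (r : seq I) (F : I -> R -> C) : (forall i, ccont (F i)) ->
  ccont (fun t => \sum_(i <- r) F i t).
Proof.
move=> cF; elim: r => [|i r IH].
  by under eq_fun do rewrite big_nil; exact: ccont_cst.
by under eq_fun do rewrite big_cons; exact: ccontD.
Qed.

Lemma ccontX F n : ccont F -> ccont (fun t => F t ^+ n).
Proof.
move=> cF; elim: n => [|n IH].
  by under eq_fun do rewrite expr0; exact: ccont_cst.
by under eq_fun do rewrite exprS; exact: ccontM.
Qed.

Lemma ccont_horner a F : ccont F -> ccont (fun t => a.[F t]).
Proof.
move=> cF; under eq_fun do rewrite horner_coef.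
apply: ccont_sum => i; apply: ccontM; first exact: ccont_cst.
exact: ccontX.
Qed.

Lemma circ_avg_lin c F G : ccont F -> ccont G ->
  circ_avg (fun t => c * F t + G t) = c * circ_avg F + circ_avg G.
Proof.
move=> [a1 a2] [b1 b2]; rewrite /circ_avg mulrCA -mulrDr; congr (_ * _).
have Re_int : circ_int (fun t => complex.Re (c * F t + G t)) =
    complex.Re c * circ_int (fun t => complex.Re (F t))
    + (- complex.Im c) * circ_int (fun t => complex.Im (F t))
    + circ_int (fun t => complex.Re (G t)).
  have cM (r : R) f : continuous f -> continuous (fun t : R => r * f t) := contM (@cont_cst r).
  rewrite -!circ_intZ //; rewrite -circ_intD; [|exact: cM|exact: cM].
  rewrite -circ_intD; [|by apply: contD; exact: cM|by []].
  by congr circ_int; apply/funext => t; rewrite Re_add Re_mul mulNr.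
have Im_int : circ_int (fun t => complex.Im (c * F t + G t)) =
    complex.Re c * circ_int (fun t => complex.Im (F t))
    + complex.Im c * circ_int (fun t => complex.Re (F t))
    + circ_int (fun t => complex.Im (G t)).
  have cM (r : R) f : continuous f -> continuous (fun t : R => r * f t) := contM (@cont_cst r).
  rewrite -!circ_intZ //; rewrite -circ_intD; [|exact: cM|exact: cM].
  rewrite -circ_intD; [|by apply: contD; exact: cM|by []].
  by congr circ_int; apply/funext => t; rewrite Im_add Im_mul.
rewrite Re_int Im_int; apply: complex_eq.
- by rewrite Re_add Re_mul /= mulNr.
- by rewrite Im_add Im_mul /=.
Qed.

Lemma circ_avg0 : circ_avg (fun=> 0) = 0.
Proof.
have h := circ_avg_lin (-1) (ccont_cst 0) (ccont_cst 0).
have e : (fun _ : R => -1 * 0 + 0 : C) = (fun=> 0).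
  by apply/funext => t; rewrite mulr0 addr0.
by rewrite e in h; rewrite h mulN1r addNr.
Qed.

Lemma circ_avg_sum I (r : seq I) (F : I -> R -> C) (c : I -> C) :
  (forall i, ccont (F i)) ->
  circ_avg (fun t => \sum_(i <- r) c i * F i t) = \sum_(i <- r) c i * circ_avg (F i).
Proof.
move=> cF; elim: r => [|i r IH].
  by rewrite big_nil; under [X in circ_avg X]eq_fun do rewrite big_nil; exact: circ_avg0.
rewrite big_cons; under [X in circ_avg X]eq_fun do rewrite big_cons.
rewrite circ_avg_lin ?IH //; apply: ccont_sum => j.
by apply: ccontM => //; exact: ccont_cst.
Qed.

Lemma expiD (s t : R) : expi (s + t) = expi s * expi t.
Proof.
by apply: complex_eq; rewrite ?Re_mul ?Im_mul /= ?cosD ?sinD // addrC.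
Qed.

Lemma expi0 : expi (0 : R) = 1.
Proof. by apply: complex_eq; rewrite /= ?cos0 ?sin0. Qed.

Lemma expiJ (t : R) : Num.conj (expi t) = expi (- t).
Proof. by apply: complex_eq; rewrite ?Re_cj ?Im_cj /= ?cosN ?sinN. Qed.

Lemma expi_neq0 (t : R) : expi t != 0.
Proof.
apply/eqP => e0; have := expiD t (- t); rewrite e0 mul0r addrN expi0 => /eqP.
by rewrite oner_eq0.
Qed.

Lemma expiN (t : R) : expi (- t) = (expi t)^-1.
Proof.
by apply: (mulfI (expi_neq0 t)); rewrite mulfV ?expi_neq0 // -expiD addrN expi0.
Qed.

Lemma expi_exp (t : R) k : expi t ^ k = expi (k%:~R * t).
Proof.
have expn n : expi t ^+ n = expi (n%:R * t).
  elim: n => [|n IH]; first by rewrite mul0r expi0.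
  by rewrite exprS IH -expiD -[in RHS]natr1 mulrDl mul1r addrC.
case: k => n; first by rewrite -exprnP expn.
by rewrite NegzE -exprnN expn -expiN mulrNz mulNr.
Qed.

Lemma sqmod_expi (t : R) : sqmod (expi t) = 1.
Proof. exact: cos2Dsin2. Qed.

Lemma ccont_expi : ccont (@expi R).
Proof. by split; [exact: continuous_cos|exact: continuous_sin]. Qed.

Lemma ccont_expiX k : ccont (fun t => expi t ^ k).
Proof.
case: k => n; first exact: ccontX ccont_expi.
apply: ccontV => [|t]; first exact: ccontX ccont_expi.
by rewrite expf_neq0 ?expi_neq0.
Qed.

Lemma circ_int_FTC (f F : R -> R) : continuous f ->
  (forall t, is_derive t (1 : R) F (f t)) -> circ_int f = F (pi *+ 2) - F 0.
Proof.
move=> cf dF; have pi0 : (0 : R) < pi *+ 2 by rewrite mulrn_wgt0 // pi_gt0.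
have cF : continuous F.
  move=> t; apply: differentiable_continuous; apply/derivable1_diffP.
  exact: ex_derive.
rewrite /circ_int /Rintegral (@continuous_FTC2 _ f F) //.
- exact: continuous_subspaceT.
- split; first by move=> t _; exact: ex_derive.
    by apply: cvg_at_right_filter; exact: cF.
  by apply: cvg_at_left_filter; exact: cF.
- by move=> t _; rewrite derive1E; exact: derive_val.
Qed.

Lemma is_derive_scale (r t : R) : is_derive t (1 : R) (fun t => r * t) r.
Proof.
have := is_deriveZ r (is_derive_id t (1 : R)).
by rewrite /GRing.scale /= mulr1.
Qed.

Lemma circ_avg_expi k : circ_avg (fun t => expi t ^ k) = (k == 0)%:R.
Proof.
have [->|k0] := eqVneq k 0.
  have pi0 : (pi *+ 2 : R) != 0 by rewrite mulrn_eq0 /= lt0r_neq0 // pi_gt0.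
  have e1 : circ_int (fun=> 1) = pi *+ 2.
    rewrite (@circ_int_FTC _ id) ?subr0 //; first exact: cont_cst.
  have e0 : circ_int (fun=> 0) = 0.
    rewrite (@circ_int_FTC _ (fun=> 0)) ?subr0 //; first exact: cont_cst.
  by rewrite /circ_avg e1 e0; apply: complex_eq;
    rewrite ?Re_mul ?Im_mul /= ?mulr0 ?mul0r ?subr0 ?addr0 // mulVf.
have kr0 : (k%:~R : R) != 0 by rewrite intr_eq0.
have per : expi (k%:~R * (pi *+ 2) : R) = 1.
  rewrite -expi_exp (_ : expi (pi *+ 2) = 1) ?exp1rz //.
  by apply: complex_eq; rewrite /= ?cos2pi ?sin2pi.
have cper : cos (k%:~R * (pi *+ 2) : R) = 1 := congr1 (@complex.Re R) per.
have sper : sin (k%:~R * (pi *+ 2) : R) = 0 := congr1 (@complex.Im R) per.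
have cl : continuous (fun t : R => k%:~R * t).
  by apply: contM; [exact: cont_cst|by move=> t; exact: cvg_id].
have dl (t : R) : is_derive t (1 : R) (fun t => k%:~R * t) k%:~R.
  exact: is_derive_scale.
have ec : circ_int (fun t => cos (k%:~R * t)) = 0.
  have cc : continuous (fun t : R => cos (k%:~R * t)).
    by move=> t; apply: continuous_comp; [exact: cl|exact: continuous_cos].
  have dS (t : R) : is_derive t (1 : R) (fun t => k%:~R^-1 * sin (k%:~R * t)) (cos (k%:~R * t)).
    have ds := is_derive1_comp (is_derive_sin (k%:~R * t)) (dl t).
    have := is_deriveZ (k%:~R^-1 : R) ds.
    by rewrite /GRing.scale /= mulrCA mulVf // mulr1.
  rewrite (circ_int_FTC cc dS).
  by rewrite mulr0 sin0 sper mulr0 subrr.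
have es : circ_int (fun t => sin (k%:~R * t)) = 0.
  have cc : continuous (fun t : R => sin (k%:~R * t)).
    by move=> t; apply: continuous_comp; [exact: cl|exact: continuous_sin].
  have dS (t : R) : is_derive t (1 : R) (fun t => - k%:~R^-1 * cos (k%:~R * t)) (sin (k%:~R * t)).
    have ds := is_derive1_comp (is_derive_cos (k%:~R * t)) (dl t).
    have := is_deriveZ (- k%:~R^-1 : R) ds.
    by rewrite /GRing.scale /= !mulNr mulrN opprK mulrCA mulVf // mulr1.
  rewrite (circ_int_FTC cc dS).
  by rewrite mulr0 cos0 cper subrr.
rewrite /circ_avg; under [X in circ_int X]eq_fun do rewrite expi_exp /=.
under [X in Complex _ (circ_int X)]eq_fun do rewrite expi_exp /=.
by rewrite ec es -[Complex 0 0]/(0 : C) mulr0.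
Qed.

Lemma circ_int_bound (f : R -> R) (B : R) : continuous f ->
  (forall t, 0 <= t <= pi *+ 2 -> `|f t| <= B) -> `|circ_int f| <= B * (pi *+ 2).
Proof.
move=> cf hB; have pi0 : (0 : R) < pi *+ 2 by rewrite mulrn_wgt0 // pi_gt0.
have e1 : circ_int (fun=> B) = B * (pi *+ 2).
  rewrite (circ_int_FTC (@cont_cst B) (is_derive_scale B)).
  by rewrite mulr0 subr0.
rewrite -e1; apply: le_trans (le_normr_Rintegral _ _) _ => //.
  exact: cont_integrable.
apply: le_Rintegral => //.
- apply: cont_integrable => t; apply: cvg_norm; exact: cf.
- by apply: cont_integrable; exact: cont_cst.
Qed.

(** A bound uniform in [k] is all that [bounded_recurrence] asks of Fourier coefficients; no decay
    is required. *)
Lemma circ_avg_bounded F : ccont F ->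
  exists M : R, forall k, sqmod (circ_avg (fun t => F t * expi t ^ k)) <= M.
Proof.
move=> cF; have pi0 : (0 : R) < pi *+ 2 by rewrite mulrn_wgt0 // pi_gt0.
have [t0 _ ht0] := @EVT_max R (fun t => sqmod (F t)) 0 (pi *+ 2) (ltW pi0)
  (continuous_subspaceT (cont_sqmod cF)).
(* The added [1] gives [B >= 1], so that [x ^+ 2 <= B] yields [|x| <= B] without a square root. *)
set B := sqmod (F t0) + 1; have B1 : 1 <= B by rewrite lerDr sqmod_ge0.
exists (B ^+ 2 + B ^+ 2) => k; set G := fun t => F t * expi t ^ k.
have cG : ccont G by apply: ccontM => //; exact: ccont_expiX.
have GB t : 0 <= t <= pi *+ 2 -> `|complex.Re (G t)| <= B /\ `|complex.Im (G t)| <= B.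
  move=> ht; have : sqmod (G t) <= B.
    rewrite /G sqmodM expi_exp sqmod_expi mulr1 (le_trans (ht0 t _)) ?in_itv //.
    by rewrite lerDl.
  rewrite /sqmod !ler_norml; have := sqr_ge0 (complex.Re (G t)).
  have := sqr_ge0 (complex.Im (G t)).
  move: (complex.Re _) (complex.Im _) => x y y0 x0 xy.
  by split; apply/andP; split; nra.
have [c1 c2] := cG.
have h1 := circ_int_bound c1 (fun t ht => proj1 (GB t ht)).
have h2 := circ_int_bound c2 (fun t ht => proj2 (GB t ht)).
rewrite /circ_avg sqmodM sqmod_real /sqmod /= exprVn mulrDr.
have sq (x : R) : `|x| <= B * (pi *+ 2) -> (pi *+ 2) ^- 2 * x ^+ 2 <= B ^+ 2.
  move=> hx; rewrite ler_pdivrMl ?exprn_gt0 // mulrC -exprMn -real_normK ?num_real //.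
  by rewrite lerXn2r ?nnegrE // mulr_ge0 // ltW // (lt_le_trans ltr01).
by apply: lerD; apply: sq.
Qed.

Lemma bounded_sum n (c : nat -> C) (d : nat -> int -> C) :
  (forall j, exists M : R, forall k, sqmod (d j k) <= M) ->
  exists M : R, forall k, sqmod (\sum_(j < n) c j * d j k) <= M.
Proof.
move=> hd; elim: n => [|n [M hM]]; first by exists 0 => k; rewrite big_ord0 sqmod0.
have [M' hM'] := hd n; exists (2 * M + 2 * (sqmod (c n) * M')) => k.
rewrite big_ord_recr /=; apply: le_trans (sqmodD_le _ _) _.
rewrite sqmodM; apply: lerD; apply: ler_wpM2l => //; apply: ler_wpM2l => //.
exact: sqmod_ge0.
Qed.

Lemma geometric_bounded (s x M : R) : 1 < s -> (forall t : nat, s ^+ t * x <= M) -> x <= 0.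
Proof.
move=> s1 h; have s0 : 0 < s by apply: lt_trans s1.
have c0 : M * s^-1 ^+ t @[t --> \oo] --> (0 : R).
  have := cvgM (cvg_cst M) (@cvg_expr R s^-1 _); rewrite mulr0; apply.
  by rewrite ger0_norm ?invr_ge0 ?ltW // invf_lt1.
rewrite -(cvg_lim (@Rhausdorff R) c0); apply: limr_ge; first by apply: cvgP c0.
by apply: nearW => t; rewrite exprVn ler_pdivlMr ?exprn_gt0 // mulrC.
Qed.

(* A factor [X - z] with [|z| > 1] turns the recurrence into [D (k - t) = z^t D k],
   which is unbounded to the left unless [D = 0]. *)
Lemma bounded_recurrence n b (d : int -> C) : (size b <= n)%N ->
  (forall z, sqmod z <= 1 -> b.[z] != 0) ->
  (exists M : R, forall k, sqmod (d k) <= M) ->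
  (forall k, \sum_(j < n) b`_j * d (k - j%:Z) = 0) -> forall k, d k = 0.
Proof.
elim: n b d => [|n IH] b d sb hb bd hd k.
  move: sb (hb 0); rewrite leqn0 size_poly_eq0 => /eqP ->.
  by rewrite horner0 eqxx sqmod0 ler01 => /(_ isT).
have [sb1|sb1] := leqP (size b) 1.
  have := hd k; rewrite big_ord_recl /= subr0 big1 ?addr0; last first.
    by move=> j _; rewrite nth_default ?mul0r // (leq_trans sb1).
  move/eqP; rewrite mulf_eq0 => /orP[/eqP b0|/eqP //].
  have := hb 0; rewrite sqmod0 ler01 (size1_polyC sb1) hornerC b0 eqxx.
  by move=> /(_ isT).
have [z rz] := poly_root_ex sb1.
have z1 : 1 < sqmod z.
  by rewrite ltNge; apply: contraL rz => /hb; rewrite rootE.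
move/factor_theorem: rz => [c bE].
have c0 : c != 0.
  apply: contraTneq sb1 => c0; by rewrite bE c0 mul0r size_poly0.
have sc : (size c <= n)%N.
  by move: sb; rewrite bE size_Mmonic ?monicXsubC // size_XsubC addn2.
pose D (k : int) : C := \sum_(j < n) c`_j * d (k - j%:Z).
have DE k' : D (k' - 1) = z * D k'.
  have := hd k'; rewrite (eq_bigr (fun j : 'I_n.+1 =>
    (if (j : nat) == 0%N then 0 else c`_j.-1) * d (k' - j%:Z) - c`_j * z * d (k' - j%:Z))); last first.
    by move=> j _; rewrite bE mulrBr coefB coefMX coefMC mulrBl.
  rewrite sumrB big_ord_recl /= mul0r add0r [X in _ - X]big_ord_recr /=.
  rewrite [c`_n]nth_default // mul0r mul0r addr0 => /eqP; rewrite subr_eq0 => /eqP e.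
  rewrite /D mulr_sumr; under [RHS]eq_bigr do rewrite mulrA [z * _]mulrC.
  rewrite -e; apply: eq_bigr => j _; congr (_ * d _).
  by rewrite /bump /= add1n -addrA -opprD -PoszD add1n.
have Dt k' (t : nat) : D (k' - t%:Z) = z ^+ t * D k'.
  elim: t => [|t IHt]; first by rewrite subr0 mul1r.
  by rewrite -addn1 PoszD opprD addrA DE IHt exprD expr1 mulrA [z * _]mulrC.
have D0 k' : D k' = 0.
  have [M hM] : exists M : R, forall k, sqmod (D k) <= M.
    apply: (@bounded_sum n (fun j => c`_j) (fun j k => d (k - j%:Z))) => j.
    by case: bd => M hM; exists M.
  apply: sqmod_eq0; apply/eqP; rewrite eq_le sqmod_ge0 andbT.
  apply: (geometric_bounded (M := M) z1) => t.
  by rewrite -sqmodX -sqmodM -Dt.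
apply: (IH c d) => // x /hb.
by rewrite bE hornerM mulf_eq0 negb_or => /andP[].
Qed.

Definition conj_ratfun a b : C -> C := fun z => a.[Num.conj z] / b.[Num.conj z].

(** The Fourier coefficients and the sequence [g], extended by [0] to negative indices, solve the
    same recurrence with coefficients [b] and right-hand side [a]. Their difference is a bounded
    solution of the homogeneous recurrence, hence zero; no series is exchanged with the integral. *)
Lemma fourier_conj_ratfun a b (g : ps1 R) :
  (forall z, sqmod z <= 1 -> b.[z] != 0) -> l2 g -> pconv b g = (fun k : nat => a`_k) ->
  forall k, fourier (conj_ratfun a b) (- k) = if k is Posz n then g n else 0.
Proof.
move=> hb hg e; set F := fun t : R => conj_ratfun a b (expi t).
have cE : ccont (fun t => Num.conj (expi t)).
  have [c1 c2] := ccont_expi; split; first by under eq_fun do rewrite Re_cj.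
  by under eq_fun do rewrite Im_cj; move=> t; apply: cvgN; exact: c2.
have bn t : b.[Num.conj (expi t)] != 0 by apply: hb; rewrite sqmodJ sqmod_expi.
have cF : ccont F.
  apply: ccontM; first exact: ccont_horner.
  by apply: ccontV => //; exact: ccont_horner.
have ck k : ccont (fun t => F t * expi t ^ k) by apply: ccontM => //; exact: ccont_expiX.
pose c k := circ_avg (fun t => F t * expi t ^ k).
pose g' k : C := if k is Posz n then g n else 0.
have expiB (t : R) k (j : nat) : expi t ^ (k - j%:Z) = expi t ^ k * Num.conj (expi t) ^+ j.
  by rewrite expfzDr ?expi_neq0 // -exprnN expiJ expiN exprVn.
(* On the circle [b(conj z) F = a(conj z)]; multiply by [z ^ k] and average, with
   [conj z = z^-1]. *)
have rc k : \sum_(j < size b) b`_j * c (k - j%:Z) = if k is Posz n then a`_n else 0.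
  rewrite -(circ_avg_sum _ (fun j : 'I__ => b`_j)) //.
  transitivity (circ_avg (fun t => \sum_(j < size a) a`_j * expi t ^ (k - j%:Z))).
    congr circ_avg; apply/funext => t.
    rewrite (eq_bigr (fun j : 'I__ => F t * expi t ^ k * (b`_j * Num.conj (expi t) ^+ j))); last first.
      by move=> j _; rewrite expiB [F t * (_ * _)]mulrA mulrCA.
    rewrite [RHS](eq_bigr (fun j : 'I__ => expi t ^ k * (a`_j * Num.conj (expi t) ^+ j))); last first.
      by move=> j _; rewrite expiB mulrCA.
    rewrite -!mulr_sumr -!horner_coef /F /conj_ratfun [X in X * _]mulrC -mulrA.
    by rewrite divfK.
  rewrite (circ_avg_sum _ (fun j : 'I__ => a`_j)); last first.
    by move=> j; exact: ccont_expiX.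
  under eq_bigr do rewrite circ_avg_expi subr_eq0.
  case: k => n; last by rewrite big1 // => j _; rewrite mulr0.
  have [na|na] := ltnP n (size a).
    rewrite (bigD1 (Ordinal na)) //= eqxx mulr1 big1 ?addr0 // => j jn.
    rewrite eqz_nat; case: eqP => [ej|_]; last by rewrite mulr0.
    by case/eqP: jn; apply: val_inj.
  rewrite nth_default // big1 // => j _.
  by rewrite eqz_nat gtn_eqF ?mulr0 // (leq_trans (ltn_ord j)).
(* The convolution identity for [g], now over all integers: terms with negative index are zero on
   both sides. *)
have rg k : \sum_(j < size b) b`_j * g' (k - j%:Z) = if k is Posz n then a`_n else 0.
  case: k => n; last first.
    rewrite big1 // => j _; have -> : Negz n - j%:Z = Negz (n + j) by lia.
    by rewrite mulr0.
  rewrite -[a`_n](congr1 (fun u => u n) e) /pconv.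
  pose U j := b`_j * g' (n%:Z - j%:Z).
  transitivity (\sum_(j < maxn (size b) n.+1) U j).
    apply/esym/sum_ord_widen; first exact: leq_maxl.
    by move=> j bj; rewrite /U nth_default // mul0r.
  transitivity (\sum_(j < n.+1) U j).
    apply: sum_ord_widen; first exact: leq_maxr.
    move=> j nj; rewrite /U -opprB subzn ?(ltnW nj) //.
    case: (j - n)%N (subn_gt0 n j) => [|l _]; first by rewrite nj.
    by rewrite -NegzE /= mulr0.
  by apply: eq_bigr => -[j /=]; rewrite ltnS => jn _; rewrite /U subzn.
move=> k; rewrite fourierE opprK -/(c k) -/(g' k); apply/eqP; rewrite -subr_eq0; apply/eqP.
apply: (@bounded_recurrence (size b) b (fun k => c k - g' k)) => //.
- have [M hM] := circ_avg_bounded cF; have [M' hM'] := hg.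
  exists (2 * M + 2 * M') => l; apply: le_trans (sqmodD_le _ _) _.
  rewrite sqmodN; apply: lerD; apply: ler_wpM2l => //; first exact: hM.
  case: l => l; last by rewrite sqmod0 (le_trans _ (hM' 0%N)) // big_ord0.
  apply: le_trans (hM' l.+1); rewrite big_ord_recr /= lerDr.
  by apply: sumr_ge0 => j _; exact: sqmod_ge0.
- move=> l; under eq_bigr do rewrite mulrBr.
  by rewrite sumrB rc rg subrr.
Qed.

Lemma conj_ratfun_cont a b : (forall z, sqmod z <= 1 -> b.[z] != 0) ->
  rational_conj_cont (conj_ratfun a b).
Proof.
move=> hb; split.
  exists a, b; split=> //; apply/eqP => b0.
  by have := hb 0; rewrite sqmod0 ler01 b0 horner0 eqxx => /(_ isT).
apply: continuous_in_subspaceT => z; rewrite inE /closed_disk /= norm_le1 => z1.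
apply: (@continuous_ratfun_isometry C (fun z => Num.conj z)).
  by move=> x y; rewrite -rmorphB norm_conjC.
by apply: hb; rewrite sqmodJ.
Qed.

End Fourier.


(** * Polynomial linear systems *)

Section FractionMatrices.
Variable A : idomainType.
Local Notation toF := (@FracField.tofrac A).

Lemma frac_clear (x : {fraction A}) :
  exists d n : A, d != 0 /\ toF d * x = toF n.
Proof.
elim/quotW: x => r; exists (r.2), (r.1); split; first exact: denom_ratioP.
unlock FracField.tofrac; rewrite -[LHS]FracField.pi_mul; apply/eqP.
rewrite FracField.equivf_def /FracField.mulf !numden_Ratio ?mulf_neq0 ?oner_neq0 ?denom_ratioP //.
by rewrite mulr1 mul1r mulrC.
Qed.

Lemma mx_clear m n (M : 'M[{fraction A}]_(m, n)) :
  exists (d : A) (N : 'M[A]_(m, n)), d != 0 /\ map_mx toF N = toF d *: M.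
Proof.
have /choice[dn hdn] : forall ij : 'I_m * 'I_n, exists dn : A * A,
    dn.1 != 0 /\ toF dn.1 * M ij.1 ij.2 = toF dn.2.
  by move=> ij; have [d [k h]] := frac_clear (M ij.1 ij.2); exists (d, k).
exists (\prod_ij (dn ij).1).
exists (\matrix_(i, j) ((\prod_(kl | kl != (i, j)) (dn kl).1) * (dn (i, j)).2)).
split; first by apply/prodf_neq0 => ij _; case: (hdn ij).
apply/matrixP => i j; rewrite !mxE [in RHS](bigD1 (i, j)) //= !tofracM.
by case: (hdn (i, j)) => _ /= <-; rewrite mulrA; congr (_ * _); rewrite mulrC.
Qed.

(** A kernel vector over the fraction field, cleared of denominators, would be one over [A]; so [M]
    is row-free there. Its right inverse, cleared in the same way, is [N], and [d] is the common
    denominator. *)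
Lemma poly_left_inverse m n (M : 'M[A]_(m, n)) :
  (forall h : 'rV[A]_m, h *m M = 0 -> h = 0) ->
  exists (d : A) (N : 'M[A]_(n, m)), d != 0 /\ M *m N = d%:M.
Proof.
move=> hM.
have injF k l : injective (@map_mx _ _ toF k l).
  move=> X Y /matrixP e; apply/matrixP => i j; have := e i j; rewrite !mxE => /eqP.
  by rewrite tofrac_eq => /eqP.
have rf : row_free (map_mx toF M).
  rewrite -kermx_eq0; apply/eqP/row_matrixP => i; rewrite row0.
  have [d [h [d0 hE]]] := mx_clear (row i (kermx (map_mx toF M))).
  have : h *m M = 0.
    apply: injF; rewrite map_mxM hE -scalemxAl -row_mul mulmx_ker row0 scaler0.
    by rewrite map_mx0.
  move/hM => h0; move/eqP: hE; rewrite h0 map_mx0 eq_sym scaler_eq0 tofrac_eq0.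
  by rewrite (negbTE d0) => /eqP.
have /row_freeP[B hB] := rf.
have [d [N [d0 NE]]] := mx_clear B; exists d, N; split=> //.
apply: injF; rewrite map_mxM NE -scalemxAr hB map_scalar_mx /=.
by rewrite scalemx1.
Qed.

End FractionMatrices.


(** * Orthonormal expansions and the Wold decomposition *)

Section Expansions.
Context {R : realType}.
Local Notation C := R[i].
Implicit Types (f g h : ps2 R) (v : ps1 R) (c : C).

Lemma cauchyR (x : nat -> R) (eps : nat -> R) :
  (forall k l, (x k - x l) ^+ 2 <= eps k + eps l) ->
  eps k @[k --> \oo] --> (0 : R) -> exists y : R, x k @[k --> \oo] --> y.
Proof.
move=> hx he; suff : cvg (x k @[k --> \oo]) by move=> cx; exists (lim (x k @[k --> \oo])).
apply/cauchy_cvgP; apply: cauchy_exP => e e0.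
have e2 : 0 < e ^+ 2 / 2 by rewrite divr_gt0 // exprn_gt0.
have /cvgrPdist_lt/(_ _ e2)[N _ hN] := he.
exists (x N); exists N => // k /= Nk.
have := hN _ Nk; rewrite /= sub0r normrN => h1.
have := hN N (leqnn N); rewrite /= sub0r normrN => h2.
have : `|x N - x k| ^+ 2 < e ^+ 2.
  rewrite real_normK ?num_real //; apply: le_lt_trans (hx _ _) _.
  by rewrite [ltRHS]splitr ltrD // (le_lt_trans (ler_norm _)).
by rewrite ltr_pXn2r // nnegrE ?normr_ge0 // ltW.
Qed.

Lemma cauchyC (u : nat -> C) (eps : nat -> R) :
  (forall k l, sqmod (u k - u l) <= eps k + eps l) ->
  eps k @[k --> \oo] --> (0 : R) -> exists y : C, cvgC u y.
Proof.
move=> hu he.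
have [|a ha] := @cauchyR (fun k => complex.Re (u k)) eps _ he.
  move=> k l; apply: le_trans (hu k l); rewrite /sqmod Re_add Re_opp.
  by rewrite lerDl sqr_ge0.
have [|b hb] := @cauchyR (fun k => complex.Im (u k)) eps _ he.
  move=> k l; apply: le_trans (hu k l); rewrite /sqmod Im_add Im_opp.
  by rewrite lerDr sqr_ge0.
by exists (Complex a b); apply/cvgCP.
Qed.

(** Entrywise limits exist by completeness of [C], and [psum_fatou] in [l] bounds the distance from
    [u k] to the limit by [eps k]. The modulus [eps k + eps l] is the form that a minimizing
    sequence provides. *)
Lemma H2_complete (u : nat -> ps2 R) (eps : nat -> R) : (forall k, inH2 (u k)) ->
  (forall k l, nsq (ps_sub (u k) (u l)) <= eps k + eps l) ->
  eps k @[k --> \oo] --> (0 : R) ->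
  exists f, [/\ inH2 f, (forall i j, cvgC (fun k => u k i j) (f i j)) & ncvg u f].
Proof.
move=> uH hu he.
have /choice[f hf] : forall i, exists fi : ps1 R, forall j, cvgC (fun k => u k i j) (fi j).
  move=> i; suff /choice[fi hfi] : forall j, exists y : C, cvgC (fun k => u k i j) y.
    by exists fi.
  move=> j; apply: cauchyC he => k l; apply: le_trans (hu k l).
  exact: (nsq_term i j (inH2_sub (uH k) (uH l))).
have lim k : forall N, psum N (ps_sub (u k) f) <= eps k.
  move=> N; apply: (@psum_fatou R (fun l => ps_sub (u k) (u l)) _ (fun l => eps k + eps l)).
  - move=> i j; rewrite /ps_sub -[u k i j - _]addrC -mulN1r.
    under eq_fun do rewrite -[u k i j - _]addrC -mulN1r.
    by apply: cvgCD (cvgC_cst _); apply: cvgCM (hf i j); exact: cvgC_cst.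
  - apply: nearW => l; apply: le_trans (hu k l).
    exact: (psum_le_nsq _ (inH2_sub (uH k) (uH l))).
  - by rewrite -[X in _ --> X]addr0; apply: cvgD he; exact: cvg_cst.
have fH : inH2 f.
  have [dH _] := nsq_le (lim 0%N).
  have := inH2_psl (-1) dH (uH 0%N); congr inH2; apply/funext => i; apply/funext => j.
  by rewrite /psl /ps_sub mulN1r opprB subrK.
exists f; split=> //; apply: (squeeze_cvgr _ (cvg_cst 0) he).
apply: nearW => k; have [dH le] := nsq_le (lim k).
by rewrite le nsq_ge0.
Qed.

Definition psc c f : ps2 R := fun i j => c * f i j.

Lemma pscE c f : psc c f = psl c f (@ps_zero R).
Proof. by apply/funext => i; apply/funext => j; rewrite /psl /psc addr0. Qed.

Lemma inH2_psc c f : inH2 f -> inH2 (psc c f).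
Proof. by move=> fH; rewrite pscE; apply: inH2_psl => //; exact: inH2_zero. Qed.

Lemma ip_psc c f g : inH2 f -> inH2 g -> ip (psc c f) g = c * ip f g.
Proof.
by move=> fH gH; rewrite pscE ip_psl ?ip_zerol ?addr0 //; exact: inH2_zero.
Qed.

Definition lincomb (v : ps1 R) (F : nat -> ps2 R) (r : seq nat) : ps2 R :=
  pssum r (fun k => psc (v k) (F k)).

Lemma lincomb_cons v F k r : lincomb v F (k :: r) = psl (v k) (F k) (lincomb v F r).
Proof.
rewrite /lincomb pssum_cons; apply/funext => i; apply/funext => j.
by rewrite /psl /psc mul1r.
Qed.

Lemma inH2_lincomb v F r : (forall k, inH2 (F k)) -> inH2 (lincomb v F r).
Proof. by move=> FH; apply: inH2_pssum => k; exact: inH2_psc. Qed.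

Lemma ip_lincomb v F r g : (forall k, inH2 (F k)) -> inH2 g ->
  ip (lincomb v F r) g = \sum_(k <- r) v k * ip (F k) g.
Proof.
move=> FH gH; rewrite ip_pssum // => [|k]; last exact: inH2_psc.
by apply: eq_bigr => k _; rewrite ip_psc.
Qed.

Section Orthonormal.
Variable F : nat -> ps2 R.
Hypothesis FH : forall k, inH2 (F k).
Hypothesis Forth : forall k l, ip (F k) (F l) = (k == l)%:R.

Lemma nsq_lincomb v r : uniq r -> nsq (lincomb v F r) = \sum_(k <- r) sqmod (v k).
Proof.
elim: r => [_|k r IH /= /andP[kr ur]].
  rewrite big_nil /lincomb pssum_nil; apply/eqP; rewrite eq_le nsq_ge0 ?andbT; last exact: inH2_zero.
  apply: (proj2 (nsq_le _)) => N; rewrite /psum big1 // => i _; rewrite big1 // => j _.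
  by rewrite sqmod0.
have rH := inH2_lincomb v r FH.
rewrite lincomb_cons nsq_psl // big_cons IH //.
have -> : nsq (F k) = 1.
  by apply: (@complexI R); rewrite -ip_self // Forth eqxx.
rewrite (ip_conj rH (FH k)) ip_lincomb // big1_seq ?rmorph0 ?mulr0 ?addr0 ?mulr1 //.
move=> l /andP[_ lr]; rewrite Forth; case: eqP => [lk|_]; last by rewrite mulr0.
by move: kr; rewrite -lk lr.
Qed.

Lemma bessel f : inH2 f -> l2 (fun k => ip f (F k)).
Proof.
move=> fH; exists (nsq f) => N; set v := fun k => ip f (F k).
have sH := inH2_lincomb v (iota 0 N) FH.
have := nsq_ge0 (inH2_psl (-1) sH fH); rewrite nsq_psl // nsq_lincomb ?iota_uniq //.
rewrite ip_lincomb // (eq_bigr (fun k => real_complex R (sqmod (v k)))); last first.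
  by move=> k _; rewrite (ip_conj fH (FH k)) -sqmod_mulJ.
rewrite -rmorph_sum /= sqmodN sqmod1 mul1r mulN1r /=.
have -> : \sum_(k < N) sqmod (ip f (F k)) = \sum_(k <- iota 0 N) sqmod (v k).
  by rewrite -(big_mkord xpredT (fun k => sqmod (v k))) /index_iota subn0.
by move: (\sum_(_ <- _) _) (nsq f) => x y; lra.
Qed.

(** For [F k = z2^k f] the entries in column [j] are stationary once [N > j], so the candidate limit
    [w] is known in advance; only norm convergence remains, and it follows from the tails of the sum
    of the [sqmod (v k)]. *)
Lemma lincomb_cvg v w : l2 v ->
  (forall i j N, (j < N)%N -> lincomb v F (iota 0 N) i j = w i j) ->
  inH2 w /\ ncvg (fun N => lincomb v F (iota 0 N)) w.
Proof.
move=> [M hM] hw; pose S N := \sum_(k < N) sqmod (v k).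
have Smono : {homo S : m n / (m <= n)%N >-> m <= n}.
  by move=> m n mn; apply: (@leq_sum_ord _ (fun k => sqmod (v k))) => // k; exact: sqmod_ge0.
have cS : S N @[N --> \oo] --> limn S.
  by apply: nondecreasing_is_cvgn => //; exists M => _ [N _ <-]; exact: hM.
have SE N : \sum_(k <- iota 0 N) sqmod (v k) = S N.
  by rewrite /S -(big_mkord xpredT (fun k => sqmod (v k))) /index_iota subn0.
have Sle N : S N <= limn S.
  by apply: nondecreasing_cvgn_le => //; apply: cvgP cS.
have key N : forall K, psum K (ps_sub (lincomb v F (iota 0 N)) w) <= limn S - S N.
  (* On the [K]-block [w] equals the partial sum of length [L], so the error there is a finite
     orthonormal sum over the indices from [N] to [L - 1]. *)
  move=> K; pose L := (K + N)%N.
  have NL : iota 0 L = iota 0 N ++ iota N K by rewrite /L addnC iotaD add0n.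
  have dE : psum K (ps_sub (lincomb v F (iota 0 N)) w)
      = psum K (lincomb v F (iota N K)).
    apply: eq_bigr => i _; apply: eq_bigr => j _; rewrite -sqmodN /ps_sub opprB.
    rewrite -(hw i j L); last by rewrite (leq_trans (ltn_ord j)) // leq_addr.
    by rewrite /lincomb /pssum NL big_cat /= [X in X - _]addrC addrK.
  rewrite dE; apply: le_trans (psum_le_nsq _ (inH2_lincomb _ _ FH)) _.
  rewrite nsq_lincomb ?iota_uniq //.
  have := Sle L; rewrite -SE NL big_cat /= SE; move: (\sum_(_ <- _) _) => x; lra.
have wH : inH2 w.
  have [dH _] := nsq_le (key 0%N).
  have := inH2_psl (-1) dH (inH2_zero); congr inH2; apply/funext => i; apply/funext => j.
  by rewrite /psl /ps_sub /lincomb pssum_nil /ps_zero addr0 sub0r mulN1r opprK.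
split=> //; have c0 : limn S - S N @[N --> \oo] --> (0 : R).
  by rewrite -(subrr (limn S)); apply: cvgB cS; exact: cvg_cst.
apply: (squeeze_cvgr _ (cvg_cst 0) c0); apply: nearW => N.
by have [dH le] := nsq_le (key N); rewrite le nsq_ge0.
Qed.

End Orthonormal.

Lemma nsq_parallelogram f g : inH2 f -> inH2 g ->
  nsq (psl 1 f g) + nsq (psl (-1) f g) = 2 * nsq f + 2 * nsq g.
Proof.
move=> fH gH; rewrite !nsq_psl // sqmodN sqmod1 mul1r mulN1r mul1r Re_opp.
by move: (nsq f) (nsq g) (complex.Re _) => x y z; ring.
Qed.

Lemma inf_approx (E : set R) : E !=set0 -> (forall x, E x -> 0 <= x) ->
  exists (d : R) (u : nat -> R), [/\ (forall x, E x -> d <= x),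
    (forall k, E (u k)) & forall k, u k <= d + k.+1%:R^-1].
Proof.
move=> E0 Eb; have hi : has_inf E by split=> //; exists 0 => x; exact: Eb.
have /choice[u hu] : forall k : nat, exists x, E x /\ x <= inf E + k.+1%:R^-1.
  move=> k; have k0 : (0 : R) < k.+1%:R^-1 by rewrite invr_gt0 ltr0n.
  by have [x Ex lx] := inf_adherent k0 hi; exists x; split=> //; exact: ltW.
exists (inf E), u; split=> [x Ex|k|k].
- by apply: ge_inf Ex; case: hi.
- by case: (hu k).
- by case: (hu k).
Qed.

(** Moving [f] along [g] with the coefficient already used in [ip_bound] would lower the norm
    strictly unless [ip f g = 0]. *)
Lemma orth_of_minimal f g : inH2 f -> inH2 g ->
  (forall c, nsq f <= nsq (psl c g f)) -> ip f g = 0.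
Proof.
move=> fH gH hmin; set q := ip f g; set G := nsq g + 1.
have g0 := nsq_ge0 gH; have G0 : 0 < G by rewrite ltr_wpDl.
have e : G^-1 * G = 1 by rewrite mulVf // lt0r_neq0.
have t0 : 0 < G^-1 by rewrite invr_gt0.
have tn : G^-1 * nsq g = 1 - G^-1 by rewrite -e /G mulrDr mulr1 addrK.
have := hmin (real_complex R (- G^-1) * q).
rewrite nsq_psl // [ip g f]ip_conj // -/q sqmodM sqmod_real.
rewrite -(mulrA _ q (Num.conj q)) sqmod_mulJ -rmorphM /= sqrrN => H.
apply: sqmod_eq0; apply/eqP; rewrite eq_le sqmod_ge0 andbT.
have E2 : G^-1 ^+ 2 * sqmod q * nsq g = G^-1 * sqmod q * (1 - G^-1).
  by rewrite -tn; ring.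
have s0 := sqmod_ge0 q.
have : G^-1 * sqmod q <= 0 by nra.
by rewrite pmulr_rle0.
Qed.

(* Projection onto [z2 S] along a minimizing sequence, which the parallelogram law makes Cauchy. *)
Lemma proj_shift2 (S : set (ps2 R)) f : closed_subspace S -> S f ->
  exists2 g, S g & forall g', S g' -> ip (ps_sub f (shift2 g)) (shift2 g') = 0.
Proof.
move=> Scl Sf; have [SH S0 _ _] := Scl.
pose dist g := nsq (ps_sub f (shift2 g)).
have dH g : S g -> inH2 (ps_sub f (shift2 g)).
  by move=> Sg; apply: inH2_sub; [exact: SH|apply: inH2_shift2; exact: SH].
have [||d [x [dmin xE xd]]] := @inf_approx [set dist g | g in S].
- by exists (dist (@ps_zero R)); exists (@ps_zero R).
- by move=> _ [g Sg <-]; apply: nsq_ge0; exact: dH.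
have {dmin}dmin g : S g -> d <= dist g by move=> Sg; apply: dmin; exists g.
have /choice[u hu] : forall k, exists g, S g /\ dist g <= d + k.+1%:R^-1.
  by move=> k; have [g Sg gx] := xE k; exists g; split=> //; rewrite gx.
(* With distances at most [d + s] and [d + t] and a midpoint at distance at least [d], the
   parallelogram law leaves [2 (d + s) + 2 (d + t) - 4 d = 2 s + 2 t]. *)
pose eps k : R := 2 * k.+1%:R^-1.
have eps0 : eps k @[k --> \oo] --> (0 : R).
  rewrite -(mulr0 (2 : R)); apply: cvgM; first exact: cvg_cst.
  exact: cvg_harmonic.
have [hf half] : exists hf : C, 2 * hf = 1.
  by exists 2^-1; rewrite mulfV // pnatr_eq0.
have [||g [gH gpt gn]] := @H2_complete u eps _ _ eps0.
- by move=> k; apply: SH; case: (hu k).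
- move=> k l; have [Sk dk] := hu k; have [Sl dl] := hu l.
  have mid : S (psc hf (psl 1 (u k) (u l))).
    by rewrite pscE; apply: closed_psl => //; exact: closed_psl.
  have E1 : nsq (ps_sub (u k) (u l)) =
      nsq (psl (-1) (ps_sub f (shift2 (u k))) (ps_sub f (shift2 (u l)))).
    rewrite -nsq_shift2; last by apply: inH2_sub; exact: SH.
    congr nsq; apply/funext => i; apply/funext => -[|j]; rewrite /psl /ps_sub /=.
      by rewrite !subr0 mulN1r addNr.
    by rewrite mulN1r opprB addrA subrK.
  have E2 : nsq (psl 1 (ps_sub f (shift2 (u k))) (ps_sub f (shift2 (u l)))) =
      4 * dist (psc hf (psl 1 (u k) (u l))).
    have -> : psl 1 (ps_sub f (shift2 (u k))) (ps_sub f (shift2 (u l))) =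
        psl 2 (ps_sub f (shift2 (psc hf (psl 1 (u k) (u l))))) (@ps_zero R).
      apply/funext => i; apply/funext => -[|j]; rewrite /psl /ps_sub /psc /ps_zero /=.
        by rewrite !subr0 addr0 mul1r mulrDl mul1r.
      rewrite !mul1r addr0 mulrBr mulrA half mul1r mulrDl mul1r.
      by rewrite opprD addrACA.
    rewrite nsq_psl; [|exact: dH|exact: inH2_zero].
    have -> : nsq (@ps_zero R) = 0.
      by apply: (@complexI R); rewrite -ip_self ?ip_zerol //; exact: inH2_zero.
    rewrite (ip_conj inH2_zero (dH _ mid)) ip_zerol rmorph0 mulr0 /= mulr0 !addr0.
    by congr (_ * _); rewrite /sqmod /=; ring.
  have := nsq_parallelogram (dH _ Sk) (dH _ Sl); rewrite E2 -E1.
  have := dmin _ mid; move: dk dl; rewrite /eps -/(dist (u k)) -/(dist (u l)).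
  move: (dist _) (dist _) (dist _) (nsq _) (k.+1%:R^-1) (l.+1%:R^-1) => a b c e s t.
  by lra.
have Sg : S g by apply: (closed_ncvg Scl _ gH gn) => k; case: (hu k).
exists g => // g' Sg'.
have le : dist g <= d.
  apply: (proj2 (nsq_le _)) => N.
  apply: (@psum_fatou R (fun k => ps_sub f (shift2 (u k))) _ (fun k => d + k.+1%:R^-1)).
  - move=> i j; rewrite /ps_sub -[f i j - _]addrC -mulN1r.
    under eq_fun do rewrite -[f i j - _]addrC -mulN1r.
    apply: cvgCD (cvgC_cst _); apply: cvgCM; first exact: cvgC_cst.
    by case: j => [|j] /=; [exact: cvgC_cst|exact: gpt].
  - apply: nearW => k; have [Sk dk] := hu k; apply: le_trans dk.
    exact: (psum_le_nsq _ (dH _ Sk)).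
  - by rewrite -[X in _ --> X]addr0; apply: cvgD; [exact: cvg_cst|exact: cvg_harmonic].
apply: orth_of_minimal; [exact: dH|apply: inH2_shift2; exact: SH|move=> c].
apply: le_trans le _; have := dmin _ (closed_psl (- c) Scl Sg' Sg).
rewrite /dist shift2_psl; congr (_ <= nsq _); apply/funext => i; apply/funext => j.
by rewrite /ps_sub /psl mulNr opprD opprK addrCA.
Qed.

End Expansions.


(** * Coordinates in the orthonormal system [z2^k e_i] of a [z2]-invariant subspace *)

Section WanderingBasis.
Context {R : realType}.
Local Notation C := R[i].
Implicit Types (f g h : ps2 R).
Local Notation z2 := (@shift2 R).

Lemma iter_shift2E k f i j :
  iter k z2 f i j = if (k <= j)%N then f i (j - k)%N else 0.
Proof.
elim: k i j => [|k IH] i j; first by rewrite subn0.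
by rewrite iterS; case: j => [|j] //=; rewrite IH ltnS subSS.
Qed.

Lemma inH2_iter k f : inH2 f -> inH2 (iter k z2 f).
Proof. by move=> fH; elim: k => // k IH; exact: inH2_shift2. Qed.

Lemma ip_iter k f g : inH2 f -> inH2 g -> ip (iter k z2 f) (iter k z2 g) = ip f g.
Proof.
move=> fH gH; elim: k => // k IH.
by rewrite !iterS ip_shift2 //; exact: inH2_iter.
Qed.

Lemma back1_iter k f : back1 (iter k z2 f) = iter k z2 (back1 f).
Proof.
by apply/funext => i; apply/funext => j; rewrite /back1 !iter_shift2E.
Qed.

Lemma lincomb_shift2 f (v : ps1 R) i j N : (j < N)%N ->
  lincomb v (fun k => iter k z2 f) (iota 0 N) i j = ps_mul2 f v i j.
Proof.
move=> jN; rewrite /lincomb /pssum /psc.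
have -> : \sum_(k <- iota 0 N) v k * iter k z2 f i j = \sum_(k < N) v k * iter k z2 f i j.
  by rewrite -(big_mkord xpredT (fun k => v k * iter k z2 f i j)) /index_iota subn0.
rewrite (@sum_ord_widen _ (fun k => v k * iter k z2 f i j) j.+1 N) //; last first.
  by move=> k jk; rewrite iter_shift2E leqNgt jk mulr0.
rewrite (reindex_inj rev_ord_inj) /=; apply: eq_bigr => -[b /=].
rewrite ltnS => bj _; rewrite subSS iter_shift2E leq_subr subKn //.
exact: mulrC.
Qed.

Variables (m : nat) (S : set (ps2 R)) (e : 'I_m -> ps2 R).
Hypothesis Scl : closed_subspace S.
Hypothesis Sz2 : forall f, S f -> S (shift2 f).
Hypothesis ewand : forall i, S2_wandering S (e i).
Hypothesis eorth : forall i j, ip (e i) (e j) = (i == j)%:R.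

Let SH f : S f -> inH2 f. Proof. by case: Scl => h _ _ _; exact: h. Qed.

Lemma S_iter k f : S f -> S (iter k z2 f).
Proof. by move=> Sf; elim: k => // k IH; exact: Sz2. Qed.

Let Se i : S (e i). Proof. by case: (ewand i). Qed.
Let eH i : inH2 (e i). Proof. exact: SH. Qed.

(** Here [f] is any element of [S], not just a basis vector: taking [f = B e_a] later gives the
    vanishing half of the Toeplitz matrix. *)
Lemma wandering_orth k l i f : S f -> (k < l)%N ->
  ip (iter k z2 (e i)) (iter l z2 f) = 0.
Proof.
move=> Sf kl; rewrite -(subnKC kl) addSnnS iterD ip_iter //; last first.
  by apply: inH2_iter; exact: SH.
by rewrite iterS; case: (ewand i) => _; apply; exact: S_iter.
Qed.

Lemma basis_orth k l i j :
  ip (iter k z2 (e i)) (iter l z2 (e j)) = ((k == l) && (i == j))%:R.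
Proof.
have [kl|lk|->] := ltngtP k l.
- by rewrite wandering_orth.
- by rewrite (ip_conj (inH2_iter l (eH j)) (inH2_iter k (eH i))) wandering_orth // rmorph0.
- by rewrite ip_iter.
Qed.

Let Forth i k l : ip (iter k z2 (e i)) (iter l z2 (e i)) = (k == l)%:R.
Proof. by rewrite basis_orth eqxx andbT. Qed.

Let FH i k : inH2 (iter k z2 (e i)). Proof. exact: inH2_iter. Qed.

(** Meant for [f] outside [S] as well: [Uop e (hat f)] is then the projection of [f] onto [S]. *)
Definition hat f i : ps1 R := fun k => ip f (iter k z2 (e i)).

Lemma l2_hat f i : inH2 f -> l2 (hat f i).
Proof. by move=> fH; exact: (bessel (FH i) (Forth i)). Qed.

Lemma synth_cvg i (v : ps1 R) : l2 v -> inH2 (ps_mul2 (e i) v) /\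
  ncvg (fun N => lincomb v (fun k => iter k z2 (e i)) (iota 0 N)) (ps_mul2 (e i) v).
Proof.
move=> hv; apply: (lincomb_cvg (FH i) (Forth i) hv) => a b N.
exact: lincomb_shift2.
Qed.

Lemma S_synth i (v : ps1 R) : l2 v -> S (ps_mul2 (e i) v).
Proof.
move=> /(synth_cvg i)[wH wn]; apply: (closed_ncvg Scl _ wH wn) => N.
apply: closed_pssum => // k; rewrite pscE; apply: closed_psl => //.
  exact: S_iter.
by case: Scl.
Qed.

Lemma ip_synth i (v : ps1 R) g : l2 v -> inH2 g ->
  cvgC (fun N => \sum_(k < N) v k * ip (iter k z2 (e i)) g) (ip (ps_mul2 (e i) v) g).
Proof.
move=> /(synth_cvg i)[wH wn] gH.
have := ip_ncvg (fun N => inH2_lincomb v (iota 0 N) (FH i)) wH gH wn.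
congr (cvgC _ _); apply/funext => N; rewrite ip_lincomb //.
rewrite -(big_mkord xpredT (fun k => v k * ip (iter k z2 (e i)) g)).
by rewrite /index_iota subn0.
Qed.

Lemma UopE (v : 'I_m -> ps1 R) :
  Uop e v = pssum (index_enum 'I_m) (fun i => ps_mul2 (e i) (v i)).
Proof. by []. Qed.

Lemma S_Uop (v : 'I_m -> ps1 R) : (forall i, l2 (v i)) -> S (Uop e v).
Proof. by move=> hv; rewrite UopE; apply: closed_pssum => // i; exact: S_synth. Qed.

Lemma ip_Uop (v : 'I_m -> ps1 R) g : (forall i, l2 (v i)) -> inH2 g ->
  ip (Uop e v) g = \sum_i ip (ps_mul2 (e i) (v i)) g.
Proof. by move=> hv gH; rewrite UopE ip_pssum // => i; apply: SH; exact: S_synth. Qed.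

Lemma cvgC_eventually (u : nat -> C) c N :
  (forall n, (N <= n)%N -> u n = c) -> cvgC u c.
Proof.
move=> h; apply: cvgC_sqmod; apply/cvgrPdist_le => eps eps0; exists N => // n /= Nn.
by rewrite h // subrr sqmod0 subrr normr0 ltW.
Qed.

Lemma sum_delta (v : ps1 R) k N : (k < N)%N ->
  \sum_(l < N) v l * (l == k :> nat)%:R = v k.
Proof.
move=> kN; rewrite (bigD1 (Ordinal kN)) //= eqxx mulr1 big1 ?addr0 // => l lk.
by case: eqP => [E|_]; rewrite ?mulr0 //; case/eqP: lk; apply: val_inj.
Qed.

Lemma hat_Uop (v : 'I_m -> ps1 R) i k : (forall i, l2 (v i)) ->
  ip (Uop e v) (iter k z2 (e i)) = v i k.
Proof.
move=> hv; rewrite ip_Uop // (bigD1 i) //= big1 ?addr0.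
  rewrite -(limCE (ip_synth (i := i) (hv i) (FH i k))); apply: limCE.
  apply: (@cvgC_eventually _ _ k.+1) => N kN.
  by under eq_bigr do rewrite Forth; exact: sum_delta.
move=> j ji; rewrite -(limCE (ip_synth (i := j) (hv j) (FH i k))); apply: limCE.
apply: (@cvgC_eventually _ _ 0%N) => N _; rewrite big1 // => l _.
by rewrite basis_orth (negbTE ji) andbF mulr0.
Qed.

Lemma orth_Uop (v : 'I_m -> ps1 R) g : (forall i, l2 (v i)) -> inH2 g ->
  (forall k i, ip (iter k z2 (e i)) g = 0) -> ip (Uop e v) g = 0.
Proof.
move=> hv gH hg; rewrite ip_Uop // big1 // => i _.
rewrite -(limCE (ip_synth (i := i) (hv i) gH)); apply: limCE.
apply: (@cvgC_eventually _ _ 0%N) => N _; rewrite big1 // => l _.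
by rewrite hg mulr0.
Qed.

Hypothesis espan : forall f, S2_wandering S f ->
  exists c : 'I_m -> C, f = (fun a b => \sum_(i < m) c i * e i a b).

(** The component of [f] orthogonal to [z2 S] is wandering, hence a combination of the [e_i]; being
    orthogonal to all of them, it is zero. *)
Lemma shift2_of_orth f : S f -> (forall i, ip f (e i) = 0) ->
  exists2 g, S g & f = shift2 g.
Proof.
move=> Sf fe; have [g Sg hg] := proj_shift2 Scl Sf; exists g => //.
have Szg := Sz2 Sg; set w := ps_sub f (shift2 g).
have Sw : S w by exact: closed_sub.
have wH := SH Sw; have [c wE] := espan (conj Sw hg).
have ew i : ip (e i) w = 0.
  rewrite (ip_conj wH (eH i)) ip_sub ?fe ?sub0r; try exact: SH.
  rewrite (ip_conj (eH i) (SH Szg)); case: (ewand i) => _ /(_ _ Sg) ->.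
  by rewrite rmorph0 oppr0 rmorph0.
have w0 : ip w w = 0.
  have {1}-> : w = pssum (index_enum 'I_m) (fun i => psc (c i) (e i)) by exact: wE.
  rewrite ip_pssum // => [|i]; last exact: inH2_psc.
  by rewrite big1 // => i _; rewrite ip_psc // ew mulr0.
have wz : w = @ps_zero R.
  apply: nsq_eq0 => //; rewrite -lecR; have := ip_self wH; rewrite w0 => <-.
  by [].
apply/funext => i; apply/funext => j; apply/eqP; rewrite -subr_eq0; apply/eqP.
exact: (congr1 (fun u => u i j) wz).
Qed.

(** Repeated use of [shift2_of_orth] makes [f] divisible by every power of [z2], so no coefficient
    survives: the Wold decomposition has no unitary part. *)
Lemma wold_zero f : S f -> (forall k i, ip f (iter k z2 (e i)) = 0) -> f = @ps_zero R.
Proof.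
move=> Sf hf.
have step n : exists2 g, S g /\ (forall k i, ip g (iter k z2 (e i)) = 0) & f = iter n z2 g.
  elim: n => [|n [g [Sg hg] ->]]; first by exists f.
  have [g' Sg' gE] := shift2_of_orth Sg (hg 0%N).
  exists g'; last by rewrite gE -iterSr.
  split=> // k i; rewrite -(ip_shift2 (SH Sg') (FH i k)) -gE.
  exact: (hg k.+1 i).
apply/funext => i; apply/funext => j; have [g _ ->] := step j.+1.
by rewrite iter_shift2E ltnn.
Qed.

Lemma expansion f : S f -> f = Uop e (hat f).
Proof.
move=> Sf; have fH := SH Sf; have hl i : l2 (hat f i) by exact: l2_hat.
have SU := S_Uop hl.
have d0 : ps_sub f (Uop e (hat f)) = @ps_zero R.
  apply: wold_zero; first exact: closed_sub.
  move=> k i; rewrite ip_sub //; last exact: SH.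
  by rewrite hat_Uop // subrr.
apply/funext => i; apply/funext => j; apply/eqP; rewrite -subr_eq0; apply/eqP.
exact: (congr1 (fun u => u i j) d0).
Qed.

Lemma is_proj_Uop f : inH2 f -> is_proj S f (Uop e (hat f)).
Proof.
move=> fH; have hl i : l2 (hat f i) by exact: l2_hat.
have SU := S_Uop hl; have UH := SH SU; split=> // g Sg.
have gH := SH Sg; have dH := inH2_sub fH UH.
rewrite (ip_conj gH dH) [X in ip X _](expansion Sg) orth_Uop ?rmorph0 //.
  by move=> i; exact: l2_hat.
move=> k i; rewrite (ip_conj dH (FH i k)) ip_sub // hat_Uop // subrr.
exact: rmorph0.
Qed.

(** The adjoint identity is tested on the unit vector at position [k] of component [a], whose image
    under [Uop] is [z2^k e_a]. *)
Lemma adjU_hat h (v : 'I_m -> ps1 R) : S h -> is_adjU e h v -> v = hat h.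
Proof.
move=> Sh [_ hv]; have hH := SH Sh; apply/funext => a; apply/funext => k.
pose w (i : 'I_m) : ps1 R := fun l => ((i == a) && (l == k))%:R.
have wl i : l2 (w i).
  by apply: (@l2_finite _ _ k.+1) => l kl; rewrite /w gtn_eqF ?andbF.
have := hv w (fun i => proj2 (l2P _) (wl i)).
have -> : Uop e w = iter k z2 (e a).
  apply/funext => i; apply/funext => j; rewrite /Uop (bigD1 a) //= big1 ?addr0; last first.
    by move=> b ba; rewrite /ps_mul2 big1 // => l _; rewrite /w (negbTE ba) mulr0.
  rewrite -(@lincomb_shift2 _ _ _ _ (j + k).+1); last by rewrite ltnS leq_addr.
  rewrite /lincomb /pssum /psc.
  rewrite (bigD1_seq k) ?iota_uniq ?mem_iota //=; last by rewrite ltnS leq_addl.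
  rewrite /w !eqxx mul1r big1 ?addr0 // => l lk.
  by rewrite (negbTE lk) mul0r.
rewrite (bigD1 a) //= big1 ?addr0; last first.
  move=> i ia; apply: limCE; apply: (@cvgC_eventually _ _ 0%N) => N _.
  by rewrite big1 // => l _; rewrite /w (negbTE ia) mul0r.
have -> : ip1 (w a) (v a) = Num.conj (v a k).
  apply: limCE; apply: (@cvgC_eventually _ _ k.+1) => N kN.
  rewrite -(sum_delta (fun l => Num.conj (v a l)) kN).
  by apply: eq_bigr => l _; rewrite /w eqxx /= mulrC.
by move=> E; rewrite -[LHS]conj_invol -E -ip_conj.
Qed.

End WanderingBasis.


(** * Rationality of the symbol *)

Section Rationality.
Context {R : realType}.
Local Notation C := R[i].
Implicit Types (f : ps2 R) (v : ps1 R).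

Definition ps_emb v : ps2 R := fun i j => if i is 0%N then v j else 0.

Lemma ps_mul2E f v : ps_mul2 f v = ps_mul f (ps_emb v).
Proof.
apply/funext => i; apply/funext => j; rewrite /ps_mul big_ord_recr /= subnn.
rewrite big1 ?add0r // => a _; rewrite big1 // => b _.
by rewrite -(subnSK (ltn_ord a)) mulr0.
Qed.

Lemma pconv_suml I (r : seq I) (F : I -> {poly C}) v k :
  pconv (\sum_(i <- r) F i) v k = \sum_(i <- r) pconv (F i) v k.
Proof.
rewrite /pconv exchange_big /=; apply: eq_bigr => j _.
by rewrite coef_sum mulr_suml.
Qed.

Lemma pconv_sumr I (r : seq I) (a : {poly C}) (F : I -> ps1 R) k :
  pconv a (fun k => \sum_(i <- r) F i k) k = \sum_(i <- r) pconv a (F i) k.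
Proof.
rewrite /pconv exchange_big /=; apply: eq_bigr => j _.
by rewrite mulr_sumr.
Qed.

Lemma pconv_poly (a b : {poly C}) : pconv a (fun k => b`_k) = (fun k : nat => (a * b)`_k).
Proof. by apply/funext => k; rewrite coefM. Qed.

Variables (m : nat) (p : poly2 R) (q : 'I_m -> poly2 R) (e : 'I_m -> ps2 R).
Hypothesis p00 : coef2 p 0 0 != 0.
Hypothesis pe : forall i, ps_mul (coef2 p) (e i) = coef2 (q i).

Lemma ps_mul_Uop (v : 'I_m -> ps1 R) i j :
  ps_mul (coef2 p) (Uop e v) i j = \sum_b pconv (pcoef (q b) i) (v b) j.
Proof.
have -> : Uop e v = pssum (index_enum 'I_m) (fun b => ps_mul2 (e b) (v b)) by [].
rewrite ps_mul_sum; apply: eq_bigr => b _.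
by rewrite ps_mul2E ps_mulA pe -ps_mul2E.
Qed.

(* Coefficients of [z1] in [p (back1 (e a)) = sum_b q_b v_b], cleared of the
   denominator [p(0, z2)] of the [z1^0] part of [e a]. *)
Lemma back1_system (a : 'I_m) (v : 'I_m -> ps1 R) i j : back1 (e a) = Uop e v ->
  \sum_b pconv (pcoef p 0 * pcoef (q b) i) (v b) j =
  (pcoef p 0 * pcoef (q a) i.+1 - pcoef p i.+1 * pcoef (q a) 0)`_j.
Proof.
move=> hv.
have r0 : pconv (pcoef p 0) (e a 0%N) = (fun k => (pcoef (q a) 0)`_k).
  apply/funext => k; have := congr1 (fun u => u 0%N k) (pe a).
  by rewrite ps_mul_row big_ord_recl big_ord0 addr0.
(* Row [i] of [p (B e_a)] is row [i + 1] of [p e_a = q_a] less the one term in which [p_(i+1)] meets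
   row [0] of [e_a]. *)
have r1 k : ps_mul (coef2 p) (back1 (e a)) i k =
    (pcoef (q a) i.+1)`_k - pconv (pcoef p i.+1) (e a 0%N) k.
  have -> : (pcoef (q a) i.+1)`_k = ps_mul (coef2 p) (e a) i.+1 k by rewrite pe.
  rewrite !ps_mul_row [in RHS]big_ord_recr /= subnn addrK; apply: eq_bigr => -[l /=].
  by rewrite ltnS => li _; rewrite /back1 subSn.
under eq_bigr do rewrite pconvM.
rewrite -(pconv_sumr _ _ (fun b => pconv (pcoef (q b) i) (v b))).
have -> : (fun k => \sum_b pconv (pcoef (q b) i) (v b) k) =
    (fun k => -1 * pconv (pcoef p i.+1) (e a 0%N) k + (pcoef (q a) i.+1)`_k).
  by apply/funext => k; rewrite -ps_mul_Uop -hv r1 mulN1r addrC.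
rewrite pconvD mulN1r -pconvM mulrC pconvM r0 !pconv_poly coefB addrC.
by [].
Qed.

(** After multiplication by [p], this is the independence of the [q_b] over [C[z2]]. *)
Hypothesis Uinj : forall h : 'I_m -> {poly C},
  Uop e (fun i k => (h i)`_k) = @ps_zero R -> forall i, h i = 0.

(** By independence the matrix of [back1_system] has a right inverse up to a nonzero polynomial [d];
    applying it to the system isolates [d v_b], which is thereby a polynomial. *)
Lemma coefs_rational (a b : 'I_m) (v : 'I_m -> ps1 R) : back1 (e a) = Uop e v ->
  exists d n : {poly C}, d != 0 /\ pconv d (v b) = (fun k => n`_k).
Proof.
move=> hv; pose D := (\max_(b < m) size (q b))%N.
pose M : 'M[{poly C}]_(m, D) := \matrix_(b, i) (pcoef p 0 * pcoef (q b) i).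
have p0 : pcoef p 0 != 0.
  by apply: contraNneq p00 => p0; rewrite /coef2 -[p`_0]/(pcoef p 0) p0 coef0.
have big i c : (D <= i)%N -> pcoef (q c) i = 0.
  move=> Di; rewrite /pcoef nth_default // (leq_trans _ Di) //.
  by rewrite /D (bigD1 c) //= leq_maxl.
have [h hM|d [N [d0 dN]]] := @poly_left_inverse _ _ _ M.
  (* [h M = 0] reads [p_0 sum_b h_b q_b = 0], row by row in [z1]; cancelling [p_0] gives
     [p (U h) = 0], and cancelling [p] gives [U h = 0]. *)
  apply/rowP => c; rewrite mxE; apply: (Uinj (h := fun c => h ord0 c)).
  apply: (ps_cancel p00); have -> : ps_mul (coef2 p) (@ps_zero R) = @ps_zero R.
    apply/funext => i; apply/funext => j; rewrite /ps_mul big1 // => x _.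
    by rewrite big1 // => y _; rewrite mulr0.
  apply/funext => i; apply/funext => j; rewrite ps_mul_Uop.
  under eq_bigr do rewrite pconv_poly.
  rewrite -coef_sum; have -> : \sum_c0 pcoef (q c0) i * h ord0 c0 = 0.
    have [iD|Di] := ltnP i D; last by rewrite big1 // => c0 _; rewrite big // mul0r.
    have /matrixP/(_ ord0 (Ordinal iD)) := hM; rewrite !mxE.
    move=> E; apply: (mulfI p0); rewrite mulr0 -[RHS]E mulr_sumr.
    by apply: eq_bigr => c0 _; rewrite mxE mulrC -mulrA mulrCA mulrA mulrC mulrCA.
  by rewrite coef0.
pose r (i : nat) := pcoef p 0 * pcoef (q a) i.+1 - pcoef p i.+1 * pcoef (q a) 0.
exists d, (\sum_(i < D) N i b * r i); split=> //; apply/funext => k.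
(* Column [b] of [M N = d] selects [v_b] among all the unknowns. *)
transitivity (\sum_c pconv ((M *m N) c b) (v c) k).
  rewrite (bigD1 b) //= dN mxE eqxx mulr1n big1 ?addr0 // => c cb.
  by rewrite mxE (negbTE cb) mulr0n pconv0.
transitivity (\sum_c \sum_(i < D) pconv (N i b) (pconv (M c i) (v c)) k).
  apply: eq_bigr => c _; rewrite mxE pconv_suml; apply: eq_bigr => i _.
  by rewrite mulrC pconvM.
rewrite exchange_big coef_sum; apply: eq_bigr => i _.
rewrite -(pconv_sumr _ _ (fun c => pconv (M c i) (v c))).
have -> : (fun k => \sum_c pconv (M c i) (v c) k) = (fun k => (r i)`_k).
  apply/funext => l; rewrite -(back1_system i l hv).
  by apply: eq_bigr => c _; rewrite mxE.
by rewrite pconv_poly.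
Qed.

End Rationality.

(** On the circle the symbol entry is [conj (g z)]: conjugating the coefficients of numerator and
    denominator makes it rational in [conj z], and the zeros of the denominator, being conjugated,
    stay outside the closed disk. *)
Lemma symbol_exists {R : realType} (g : ps1 R) (d n : {poly R[i]}) :
  l2 g -> d != 0 -> pconv d g = (fun k => n`_k) ->
  exists F, rational_conj_cont F /\ forall k : int,
    fourier F (- k) = if k is Posz l then Num.conj (g l) else 0.
Proof.
move=> hg d0 dg; have [a [b [hb bg]]] := l2_rational hg d0 dg.
pose cj := map_poly (@Num.conj R[i]).
have hb' z : sqmod z <= 1 -> (cj b).[z] != 0.
  move=> z1; rewrite -[z]conj_invol /cj horner_map /= conjC_eq0.
  by apply: hb; rewrite sqmodJ.
exists (conj_ratfun (cj a) (cj b)); split; first exact: conj_ratfun_cont.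
apply: (fourier_conj_ratfun (g := fun k => Num.conj (g k))) => //.
  have [M hM] := hg; exists M => N; apply: le_trans (hM N).
  by apply: ler_sum => k _; rewrite sqmodJ.
apply/funext => k; rewrite /cj coef_map /= -[a`_k](congr1 (fun u => u k) bg).
rewrite /pconv conj_sum; apply: eq_bigr => j _.
by rewrite conjM coef_map.
Qed.

(** * The compression of [M_{z1}] as a Toeplitz operator *)

Unset Implicit Arguments.

Theorem theorem3p2 (R : realType) (m n : nat) (p : poly2 R) (theta : ps2 R)
  (S1 S2 : set (ps2 R)) (q : 'I_m -> poly2 R) (e : 'I_m -> ps2 R) :
  (* Theta = p~/p is a rational inner function of degree (m,n) *)
  (forall z1 z2 : R[i], `|z1| < 1 -> `|z2| < 1 -> eval2 p z1 z2 != 0) ->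
  maxn (deg1 p) (deg1 (refl2 m n p)) = m ->
  maxn (deg2 p) (deg2 (refl2 m n p)) = n ->
  pcoprime p (refl2 m n p) ->
  (* theta = Taylor coefficients of Theta = p~/p *)
  ps_mul (coef2 p) theta = coef2 (refl2 m n p) ->
  (* K_Theta = S1 (+) S2 *)
  closed_subspace S1 -> closed_subspace S2 ->
  (forall f, S1 f \/ S2 f -> K_Theta theta f) ->
  (forall f g, S1 f -> S2 g -> ip f g = 0) ->
  (forall f, K_Theta theta f -> exists f1 f2, [/\ S1 f1, S2 f2 & f = ps_add f1 f2]) ->
  (forall f, S1 f -> S1 (shift1 f)) ->
  (forall f, S2 f -> S2 (shift2 f)) ->
  (* {q_i/p} orthonormal basis of S2 (-) z2 S2 *)
  (forall i, ps_mul (coef2 p) (e i) = coef2 (q i)) ->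
  (forall i, S2_wandering S2 (e i)) ->
  (forall i j, ip (e i) (e j) = (i == j)%:R) ->
  (forall f, S2_wandering S2 f ->
     exists c : 'I_m -> R[i], f = (fun a b => \sum_(i < m) c i * e i a b)) ->
  exists M : 'I_m -> 'I_m -> R[i] -> R[i],
    (forall i j, rational_conj_cont (M i j)) /\
    (* S^1_Theta = U T_M U^* on S2 *)
    forall (h : ps2 R) (v : 'I_m -> ps1 R),
      S2 h -> is_adjU e h v ->
      is_proj S2 (shift1 h) (Uop e (toeplitz M v)).
Proof.
move=> hp0 d1 d2 _ ptheta S1cl S2cl KS S12 Kdec S1z S2z pe ew eo es.
have hp z w : sqmod z < 1 -> sqmod w < 1 -> eval2 p z w != 0.
  by rewrite -!norm_lt1; exact: hp0.
have p00 : coef2 p 0 0 != 0.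
  have := hp 0 0; rewrite sqmod0 ltr01 => /(_ isT isT).
  by rewrite eval2E horner_coef0 coef_map /= /horner_eval horner_coef0.
have sp : (size p <= m.+1)%N.
  have : (deg1 p <= m)%N by apply: leq_trans (leq_maxl _ _) (eq_leq d1).
  by rewrite /deg1; case: (size p).
have rp : rows_le n.+1 p.
  move=> i; have h : (deg2 p <= n)%N by apply: leq_trans (leq_maxl _ _) (eq_leq d2).
  have [ilt|ile] := ltnP i (size p); last by rewrite /pcoef nth_default ?size_poly0.
  have : (size (pcoef p i) <= \max_(i < size p) size (pcoef p i))%N.
    by rewrite (bigD1 (Ordinal ilt)) //= leq_maxl.
  by move: h; rewrite /deg2; lia.
have SH1 f : S1 f -> inH2 f by case: S1cl => h _ _ _; exact: h.
have SH f : S2 f -> inH2 f by case: S2cl => h _ _ _; exact: h.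
have Binv f : S2 f -> S2 (back1 f).
  move=> Sf; have fH := SH _ Sf; have bH := inH2_back1 fH.
  have [|f1 [f2 [Sf1 Sf2 fE]]] := Kdec (back1 f).
    split=> // g gH; have tgH : inH2 (ps_mul theta g) by exact: (@inH2_inner _ m n p).
    rewrite ip_back1 // -ps_mul_shift1; case: (KS f (or_intror Sf)) => _; apply.
    exact: inH2_shift1.
  have f1H := SH1 _ Sf1; have f2H := SH _ Sf2.
  (* [ip f1 f1 = ip (B f) f1 = ip f (z1 f1)], because [f2] is orthogonal to [f1]; and [z1 f1] is
     again in [S1]. *)
  have f1z : f1 = @ps_zero R.
    apply: nsq_eq0 => //; rewrite -lecR -ip_self //.
    have -> : ip f1 f1 = ip (back1 f) f1 - ip f2 f1.
      by rewrite fE ps_addE ip_psl // mul1r addrK.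
    rewrite ip_back1 // (ip_conj (inH2_shift1 f1H) fH) (ip_conj f1H f2H).
    by rewrite !S12 ?rmorph0 ?subr0 //; exact: S1z.
  suff -> : back1 f = f2 by [].
  by rewrite fE f1z; apply/funext => i; apply/funext => j; rewrite /ps_add /ps_zero add0r.
have Se i : S2 (e i) by case: (ew i).
(* [hat_Uop] reads each coefficient of [h i] back from [Uop], and here [Uop] gives zero. *)
have Uinj (h : 'I_m -> {poly R[i]}) :
    Uop e (fun i k => (h i)`_k) = @ps_zero R -> forall i, h i = 0.
  move=> U0 i; apply/polyP => k; rewrite coef0.
  rewrite -(@hat_Uop _ _ _ _ S2cl S2z ew eo (fun i k => (h i)`_k)) ?U0 ?ip_zerol //.
  by move=> l; apply: (@l2_finite _ _ (size (h l))) => t ht; rewrite nth_default.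
pose g a b := hat e (back1 (e a)) b.
have gl a b : l2 (g a b).
  apply: (l2_hat S2cl S2z ew eo); apply: SH; exact: Binv.
have /choice[M hM] : forall ab : 'I_m * 'I_m, exists F, rational_conj_cont F /\
    forall k : int, fourier F (- k) = if k is Posz l then Num.conj (g ab.1 ab.2 l) else 0.
  move=> [a b]; have hX := expansion S2cl S2z ew eo es (Binv _ (Se a)).
  have [d [n' [d0 dg]]] := coefs_rational p00 pe Uinj b hX.
  exact: (symbol_exists (gl a b) d0 dg).
exists (fun a b => M (a, b)); split=> [a b|h v Sh hv]; first by case: (hM (a, b)).
have hH := SH _ Sh; rewrite (adjU_hat S2cl ew Sh hv).
suff -> : toeplitz (fun a b => M (a, b)) (hat e h) = hat e (shift1 h).
  exact: (is_proj_Uop S2cl S2z ew eo es (inH2_shift1 hH)).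
have hl b : l2 (hat e h b) by exact: (l2_hat S2cl S2z ew eo).
apply/funext => a; apply/funext => k.
have XS := Binv _ (Se a); have XH := SH _ XS.
have kXH := inH2_iter k XH.
(* Coordinate [(a, k)] of [z1 h] becomes [ip h (z2^k B e_a)], as [B] is adjoint to [z1] and commutes
   with [z2]; only [h] is then expanded in the Wold basis. *)
rewrite /hat (ip_conj (inH2_iter k (SH _ (Se a))) (inH2_shift1 hH)).
rewrite -(ip_back1 (inH2_iter k (SH _ (Se a))) hH) back1_iter -(ip_conj kXH hH).
rewrite {2}(expansion S2cl S2z ew eo es Sh).
rewrite (ip_Uop S2cl S2z ew eo hl kXH); apply: eq_bigr => b _; apply: limCE.
have := ip_synth S2cl S2z ew eo (i := b) (hl b) kXH.
congr (cvgC _ _); apply/funext => N; apply: eq_bigr => l _; rewrite mulrC; congr (_ * _).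
have [_ hF] := hM (a, b).
have -> : k%:Z - l%:Z = - (l%:Z - k%:Z) by rewrite opprB.
(* For [k <= l] a common factor [z2^k] drops out, leaving the coefficient of index [l - k] of
   [B e_a], conjugated. For [l < k] the Fourier index is positive and the coefficient is zero, in
   agreement with [wandering_orth]. *)
rewrite hF /=; have [kl|lk] := leqP k l.
  rewrite subzn // -{1}(subnKC kl) iterD ip_iter //; last by apply: inH2_iter; exact: SH.
  by rewrite (ip_conj XH (inH2_iter _ (SH _ (Se b)))).
rewrite (wandering_orth S2cl S2z ew _ XS lk).
have -> : l%:Z - k%:Z = Negz (k - l).-1 by lia.
by [].
Qed.
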